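(* Consider FedAS-LoRA training as described in the context, with $N$ clients, $T$ rounds, $E$ local steps per round, local learning rate $\eta_\ell$, server learning rate $\eta_g$, and participating client subsets $\mathcal{S}_t\subseteq\{1,\dots,N\}$ with $|\mathcal{S}_t|=S_t$. Suppose that the smoothness assumption, the unbiased and bounded stochastic gradient assumption, and the LoRA parameter bounds and alignment assumption stated in the context hold. The participation sequence $\mathcal{S}_0,\dots,\mathcal{S}_{T-1}$ is any realized sequence that satisfies the gradient-mass coverage condition stated in the context. Let $F_\star$ be a lower bound of the aggregate objective. Then, for both the Share-A/Local-B ($Q=A$) and the Share-B/Local-A ($Q=B$) sharing strategies, the iterates of FedAS-LoRA satisfy $$\frac{1}{NT}\sum_{t=0}^{T-1}\sum_{i=1}^{N}\mathbb{E}\big[\|\nabla f_i(U_{t,i})\|_F^2\big]\le\frac{F_0-F_\star}{\eta_\ell cT}+\frac{1}{\eta_\ell cT}\sum_{t=0}^{T-1}\left[\frac{S_t}{N}\mathcal{R}_{\mathrm{sel}}+\Big(1-\frac{S_t}{N}\Big)\mathcal{R}_{\mathrm{uns}}\right],$$ where $c$ is a positive constant (identified, together with the parameter $\rho>0$, in the context), $C_\star:=\max\{C_A,C_B\}$, $$\mathcal{R}_{\mathrm{sel}}=E\eta_\ell^2C_AC_BG_{\max}^3+\frac{3LE}{2}\eta_\ell^2(C_A^4+C_B^4)G_{\max}^2+\frac{3LE}{2}\eta_\ell^4C_A^2C_B^2G_{\max}^4+\frac{\eta_\ell}{2}G_{\max}^2+\Big(\frac{1}{2\eta_\ell}+\frac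 L2\Big)(1+\eta_g)^2\eta_\ell^2E^2C_\star^4G_{\max}^2,$$ and $$\mathcal{R}_{\mathrm{uns}}=\Big(\frac{1}{2\rho\eta_\ell}+\frac L2\Big)\eta_g^2\eta_\ell^2E^2C_\star^4G_{\max}^2 .$$
   Context: Setting. There are $N$ clients; client $i$ has a local objective $f_i$ on $\mathbb{R}^{d_{\mathrm{out}}\times d_{\mathrm{in}}}$ (the local loss as a function of the additive low-rank weight update $U=BA$, with LoRA factors $A\in\mathbb{R}^{r\times d_{\mathrm{in}}}$, $B\in\mathbb{R}^{d_{\mathrm{out}}\times r}$). $\|\cdot\|_F$ and $\langle\cdot,\cdot\rangle_F$ denote the Frobenius norm and inner product. Procedure (FedAS-LoRA). The shared factor type $Q\in\{A,B\}$ is chosen before training and then stays fixed. The server maintains the shared factor $Q_t$; each client retains its own nonshared factor. In round $t=0,\dots,T-1$ the server selects a nonempty subset $\mathcal{S}_t$ and sends $Q_t$ to its members. Each $i\in\mathcal{S}_t$ starts from $Q_{t,i}^0=Q_t$ and its retained nonshared factor, and for $e=0,\dots,E-1$ samples a mini-batch $\xi_{t,i}^e$, sets $U_{t,i}^e=B_{t,i}^eA_{t,i}^e$ and $G_{t,i}^e=\nabla f_i(U_{t,i}^e;\xi_{t,i}^e)$, and updates both factors: $$B_{t,i}^{e+1}=B_{t,i}^e-\eta_\ell G_{t,i}^eA_{t,i}^{e\top},\qquad A_{t,i}^{e+1}=A_{t,i}^e-\eta_\ell B_{t,i}^{e\top}G_{t,i}^e .$$ The server then sets $$Q_{t+1}=Q_t+\frac{\eta_g}{S_t}\sum_{i\in\mathcal{S}_t}(Q_{t,i}^E-Q_t).$$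 Each $i\in\mathcal{S}_t$ retains its updated nonshared factor ($B_{t,i}^E$ if $Q=A$, $A_{t,i}^E$ if $Q=B$), while clients outside $\mathcal{S}_t$ keep their nonshared factor unchanged. For every client $i$, $U_{t,i}=U_{t,i}^0$ is the product of the factors at the start of round $t$, i.e. formed from $Q_t$ and client $i$'s retained nonshared factor. The aggregate objective is $F_t=\frac1N\sum_{i=1}^Nf_i(U_{t,i})$. Write $\bar G_{t,i}^e=\nabla f_i(U_{t,i}^e)$. Smoothness assumption. Each $f_i$ is $L$-smooth: for all $U_1,U_2\in\mathbb{R}^{d_{\mathrm{out}}\times d_{\mathrm{in}}}$, $f_i(U_2)\le f_i(U_1)+\langle\nabla f_i(U_1),U_2-U_1\rangle_F+\frac L2\|U_2-U_1\|_F^2$. Unbiased and bounded stochastic gradient assumption. For any client $i$, $\mathbb{E}[G_{t,i}^e\mid U_{t,i}^e]=\bar G_{t,i}^e$ and $\|G_{t,i}^e\|_F\le G_{\max}$, with $G_{\max}>0$. LoRA parameter bounds and alignment assumption. There exist constants $C_A,C_B>0$ and $c_A,c_B>0$ such that $\|A_{t,i}^e\|_F\le C_A$, $\|B_{t,i}^e\|_F\le C_B$, $$\langle A_{t,i}^{e\top}A_{t,i}^e,\ \bar G_{t,i}^{e\top}\bar G_{t,i}^e\rangle_F\ge c_A\|\bar G_{t,i}^e\|_F^2,\qquad \langle B_{t,i}^eB_{t,i}^{e\top},\ \bar G_{t,i}^e\bar G_{t,i}^{e\top}\rangle_F\ge c_B\|\bar G_{t,i}^e\|_F^2 .$$ Gradient-mass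 coverage condition. With $\mathcal{G}_t^{\mathrm{sel}}=\frac1N\sum_{i\in\mathcal{S}_t}\|\nabla f_i(U_{t,i})\|_F^2$ and $\mathcal{G}_t=\frac1N\sum_{i=1}^N\|\nabla f_i(U_{t,i})\|_F^2$, there is a round-independent $\lambda$ with $0<\lambda\le\mathcal{G}_t^{\mathrm{sel}}/\mathcal{G}_t$ for every round $t$ with $\mathcal{G}_t>0$. (Under full participation one can take $\lambda=1$.) Constants $c$ and $\rho$. The paper's theorem says only that $c$ is a positive constant and uses $\rho$ without defining it; in its appendix, $\rho>0$ is the parameter in the inequality $\langle X,Y\rangle_F\le\frac{\rho\eta_\ell}{2}\|X\|_F^2+\frac{1}{2\rho\eta_\ell}\|Y\|_F^2$, and $c=(c_A+c_B)\kappa E\lambda-\frac\rho2(1-\lambda)>0$, with $\rho<\frac{2(c_A+c_B)\kappa E\lambda}{1-\lambda}$ and $\kappa\in[0,\frac1E]$. *)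

(* Defs.v *)
From HB Require Import structures.
From mathcomp Require Import all_boot all_order all_algebra.
From mathcomp Require Import all_classical all_reals all_analysis.

Set Implicit Arguments.
Unset Strict Implicit.
Unset Printing Implicit Defensive.

Import Order.TTheory GRing.Theory Num.Theory.
Import numFieldNormedType.Exports.

Local Open Scope classical_set_scope.
Local Open Scope ring_scope.

(* The norm `|X| that the library puts on matrices is the max norm, hence the
   separate Frobenius structure. *)
Definition frob_inner (R : realType) (m n : nat) (X Y : 'M[R]_(m, n)) : R :=
  \sum_(i < m) \sum_(j < n) X i j * Y i j.

Definition frob_norm (R : realType) (m n : nat) (X : 'M[R]_(m, n)) : R :=
  Num.sqrt (frob_inner X X).

(* For differentiable f this is the gradient for the Frobenius inner product. *)
Definition grad (R : realType) (m n : nat) (f : 'M[R]_(m, n) -> R)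
    (U : 'M[R]_(m, n)) : 'M[R]_(m, n) :=
  \matrix_(i < m, j < n) 'D_(delta_mx i j) f U.

Definition smooth (R : realType) (m n : nat) (L : R)
    (f : 'M[R]_(m, n) -> R) : Prop :=
  (forall U, differentiable f U) /\
  forall U1 U2, f U2 <= f U1 + frob_inner (grad f U1) (U2 - U1)
                        + L / 2 * frob_norm (U2 - U1) ^+ 2.

(* Matrices with the Borel sigma-algebra. *)
Definition borel_mx (R : realType) (m n : nat) :=
  g_sigma_algebraType (@open 'M[R]_(m, n)).

(* Z is a version of the conditional expectation E[Y | X]. *)
Definition is_cond_expectation d dS (T : measurableType d)
    (S : measurableType dS) (R : realType) (P : probability T R)
    (X : T -> S) (Y Z : T -> R) : Prop :=
  [/\ P.-integrable setT (EFin \o Y),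
      P.-integrable setT (EFin \o Z),
      measurable_fun setT (Z : g_sigma_algebra_preimageType X -> R) &
      forall D : set S, measurable D ->
        (\int[P]_(w in X @^-1` D) (Y w)%:E
         = \int[P]_(w in X @^-1` D) (Z w)%:E)%E].

Definition is_mx_cond_expectation d dS (T : measurableType d)
    (S : measurableType dS) (R : realType) (P : probability T R)
    (m n : nat) (X : T -> S) (Y Z : T -> 'M[R]_(m, n)) : Prop :=
  forall (i : 'I_m) (j : 'I_n),
    is_cond_expectation P X (fun w => Y w i j) (fun w => Z w i j).

Definition independent d d1 d2 (T : measurableType d) (S1 : measurableType d1)
    (S2 : measurableType d2) (R : realType) (P : probability T R)
    (X1 : T -> S1) (X2 : T -> S2) : Prop :=
  forall (D1 : set S1) (D2 : set S2), measurable D1 -> measurable D2 ->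
    (P (X1 @^-1` D1 `&` X2 @^-1` D2)
     = P (X1 @^-1` D1) * P (X2 @^-1` D2))%E.

Variant sharing := ShareA | ShareB.

Section FedAS_LoRA.
Variables (R : realType) (dout din r N : nat) (Xi : Type).

(* Pairs (A, B). *)
Definition factors : Type := ('M[R]_(r, din) * 'M[R]_(dout, r))%type.

Definition update (AB : factors) : 'M[R]_(dout, din) := AB.2 *m AB.1.

Definition shared_rows (Q : sharing) := if Q is ShareA then r else dout.
Definition shared_cols (Q : sharing) := if Q is ShareA then din else r.
Definition local_rows (Q : sharing) := if Q is ShareA then dout else r.
Definition local_cols (Q : sharing) := if Q is ShareA then r else din.

Definition join_factors (Q : sharing) :
    'M[R]_(shared_rows Q, shared_cols Q) ->
    'M[R]_(local_rows Q, local_cols Q) -> factors :=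
  match Q with
  | ShareA => fun A B => (A, B)
  | ShareB => fun B A => (A, B)
  end.

Definition shared_part (Q : sharing) (AB : factors) :
    'M[R]_(shared_rows Q, shared_cols Q) :=
  match Q with ShareA => AB.1 | ShareB => AB.2 end.

Definition local_part (Q : sharing) (AB : factors) :
    'M[R]_(local_rows Q, local_cols Q) :=
  match Q with ShareA => AB.2 | ShareB => AB.1 end.

Variables (Q : sharing) (etal etag : R) (E : nat).
(* g i U xi is the mini-batch gradient \nabla f_i(U; xi). *)
Variable g : 'I_N -> 'M[R]_(dout, din) -> Xi -> 'M[R]_(dout, din).
Variable S : nat -> {set 'I_N}.
Variable q0 : 'M[R]_(shared_rows Q, shared_cols Q).
Variable p0 : 'I_N -> 'M[R]_(local_rows Q, local_cols Q).
(* x t i e is the mini-batch drawn in round t by client i at local step e. *)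
Variable x : nat -> 'I_N -> nat -> Xi.

Definition local_step (i : 'I_N) (z : Xi) (AB : factors) : factors :=
  let G := g i (update AB) z in
  (AB.1 - etal *: (AB.2^T *m G), AB.2 - etal *: (G *m AB.1^T)).

Fixpoint local_run (i : 'I_N) (z : nat -> Xi) (AB : factors) (e : nat) :
    factors :=
  if e is e'.+1 then local_step i (z e') (local_run i z AB e') else AB.

(* The shared factor held by the server, with the nonshared factors retained
   by the clients. *)
Definition fed_state : Type :=
  ('M[R]_(shared_rows Q, shared_cols Q) *
   ('I_N -> 'M[R]_(local_rows Q, local_cols Q)))%type.

Definition fed_round (St : {set 'I_N}) (z : 'I_N -> nat -> Xi)
    (s : fed_state) : fed_state :=
  let end_factors i := local_run i (z i) (join_factors s.1 (s.2 i)) E in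
  (s.1 + (etag / #|St|%:R)
           *: \sum_(i in St) (shared_part Q (end_factors i) - s.1),
   fun i => if i \in St then local_part Q (end_factors i) else s.2 i).

Fixpoint fed_state_at (t : nat) : fed_state :=
  if t is t'.+1 then fed_round (S t') (x t') (fed_state_at t') else (q0, p0).

(* (A_{t,i}^e, B_{t,i}^e). These are iterates of the procedure when i \in S t
   and e <= E, or when e = 0; other values are never used by it. *)
Definition client_factors (t : nat) (i : 'I_N) (e : nat) : factors :=
  let s := fed_state_at t in
  local_run i (x t i) (join_factors s.1 (s.2 i)) e.

End FedAS_LoRA.

(* When lambda < 1, positivity of this constant is the bound
   rho < 2 (cA + cB) kappa E lambda / (1 - lambda). *)
Definition rate_const (R : realType) (E : nat)
    (cA cB kappa lambda rho : R) : R :=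
  (cA + cB) * kappa * E%:R * lambda - rho / 2 * (1 - lambda).

Definition R_sel (R : realType) (E : nat)
    (L etal etag CA CB Gmax : R) : R :=
  let Cstar := Num.max CA CB in
  E%:R * etal ^+ 2 * CA * CB * Gmax ^+ 3
  + 3 * L * E%:R / 2 * etal ^+ 2 * (CA ^+ 4 + CB ^+ 4) * Gmax ^+ 2
  + 3 * L * E%:R / 2 * etal ^+ 4 * CA ^+ 2 * CB ^+ 2 * Gmax ^+ 4
  + etal / 2 * Gmax ^+ 2
  + ((2 * etal)^-1 + L / 2) * (1 + etag) ^+ 2 * etal ^+ 2 * E%:R ^+ 2
    * Cstar ^+ 4 * Gmax ^+ 2.

Definition R_uns (R : realType) (E : nat)
    (L etal etag CA CB Gmax rho : R) : R :=
  let Cstar := Num.max CA CB in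
  ((2 * rho * etal)^-1 + L / 2) * etag ^+ 2 * etal ^+ 2 * E%:R ^+ 2
  * Cstar ^+ 4 * Gmax ^+ 2.

(* Main.v *)
Require Import Defs.
From mathcomp Require Import all_boot all_order all_algebra.
From mathcomp Require Import all_classical all_reals all_analysis.
From mathcomp Require Import measurable_realfun ring lra.

(* One local step moves U = B A by
     - etal (B B^T G + G A^T A) + etal^2 G A^T B^T G.
   Since the mini-batch is independent of the pair (A, B), and not only of U,
   replacing G by its mean in the expected inner product of the gradient with
   the first-order part is legitimate, and alignment makes that part a descent
   direction; smoothness and the parameter bounds control the rest. Aggregation
   moves each client by O(etal E): Young's inequality charges this to a bounded
   gradient for a selected client, and to rho etal / 2 times the squared gradient
   for an unselected one. Coverage turns the gradient mass of the selected
   clients into a fraction lambda of the total mass, and the resulting descent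
   of the aggregate objective telescopes.
   Integrability is never an issue: a smooth function and its gradient are
   bounded on bounded sets, so all the variables involved are essentially
   bounded. *)

Set Implicit Arguments.
Unset Strict Implicit.
Unset Printing Implicit Defensive.

Import Order.TTheory GRing.Theory Num.Theory.
Import numFieldNormedType.Exports.

Local Open Scope classical_set_scope.
Local Open Scope ring_scope.

(** * Frobenius norm *)

(** Origin of the rate: every local step of a selected client gains [etal * (cA + cB)] times the
    mean squared gradient at that step, but coverage and the conclusion only see the gradient at the
    start of the round, so the gain at [e = 0] is the one retained. An unselected client loses at
    most [rho * etal / 2] times its own. With [GS] and [GA] the selected and total gradient masses,
    the net gain is at least [etal * ((cA + cB) * GS - rho / 2 * (GA - GS))]; inserting
    [kappa * E <= 1] in front of the first term and then [lambda * GA <= GS] leaves exactly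
    [etal * c * GA]. Two obstacles shape the estimates. [Gmax] bounds the sampled gradient and not
    its mean, so every bound on the mean gradient goes through its second moment. And the parameter
    bounds concern rounds before [T], while the telescoping ends at the start of round [T]; there,
    boundedness is inherited from round [T - 1] through the displacement. *)

Section frobenius.
Context {R : realType}.
Implicit Types m n p : nat.

Lemma frob_innerC m n (X Y : 'M[R]_(m, n)) : frob_inner X Y = frob_inner Y X.
Proof. by apply: eq_bigr => i _; apply: eq_bigr => j _; rewrite mulrC. Qed.

Lemma frob_innerDl m n (X Y Z : 'M[R]_(m, n)) :
  frob_inner (X + Y) Z = frob_inner X Z + frob_inner Y Z.
Proof.
rewrite -big_split; apply: eq_bigr => i _ /=.
by rewrite -big_split; apply: eq_bigr => j _ /=; rewrite mxE mulrDl.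
Qed.

Lemma frob_innerZl m n a (X Y : 'M[R]_(m, n)) :
  frob_inner (a *: X) Y = a * frob_inner X Y.
Proof.
rewrite mulr_sumr; apply: eq_bigr => i _ /=.
by rewrite mulr_sumr; apply: eq_bigr => j _ /=; rewrite mxE mulrA.
Qed.

Lemma frob_innerNl m n (X Y : 'M[R]_(m, n)) :
  frob_inner (- X) Y = - frob_inner X Y.
Proof. by rewrite -scaleN1r frob_innerZl mulN1r. Qed.

Lemma frob_innerDr m n (X Y Z : 'M[R]_(m, n)) :
  frob_inner X (Y + Z) = frob_inner X Y + frob_inner X Z.
Proof. by rewrite !(frob_innerC X) frob_innerDl. Qed.

Lemma frob_innerZr m n a (X Y : 'M[R]_(m, n)) :
  frob_inner X (a *: Y) = a * frob_inner X Y.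
Proof. by rewrite !(frob_innerC X) frob_innerZl. Qed.

Lemma frob_innerNr m n (X Y : 'M[R]_(m, n)) :
  frob_inner X (- Y) = - frob_inner X Y.
Proof. by rewrite !(frob_innerC X) frob_innerNl. Qed.

Lemma frob_inner_ge0 m n (X : 'M[R]_(m, n)) : 0 <= frob_inner X X.
Proof. by do 2 apply: sumr_ge0 => ? _; rewrite -expr2 sqr_ge0. Qed.

Lemma frob_norm_ge0 m n (X : 'M[R]_(m, n)) : 0 <= frob_norm X.
Proof. exact: sqrtr_ge0. Qed.

Lemma frob_normE m n (X : 'M[R]_(m, n)) : frob_norm X ^+ 2 = frob_inner X X.
Proof. by rewrite sqr_sqrtr// frob_inner_ge0. Qed.

Lemma frob_norm_leP m n (X : 'M[R]_(m, n)) c : 0 <= c ->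
  (frob_norm X <= c) = (frob_inner X X <= c ^+ 2).
Proof. by move=> c0; rewrite -frob_normE ler_sqr ?nnegrE// frob_norm_ge0. Qed.

Lemma ler_frob_norm_sqr m n (X : 'M[R]_(m, n)) c :
  frob_norm X <= c -> frob_norm X ^+ 2 <= c ^+ 2.
Proof.
move=> Xc; have X0 := frob_norm_ge0 X.
by rewrite ler_sqr ?nnegrE// (le_trans X0).
Qed.

Lemma frob_norm0_eq m n (X : 'M[R]_(m, n)) : frob_norm X = 0 -> X = 0.
Proof.
move=> X0; have : frob_inner X X = 0 by rewrite -frob_normE X0 expr0n.
move/eqP; rewrite psumr_eq0; last first.
  by move=> i _; apply: sumr_ge0 => j _; rewrite -expr2 sqr_ge0.
move/allP => h; apply/matrixP => i j; rewrite mxE.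
have := h i (mem_index_enum _); rewrite /= psumr_eq0; last first.
  by move=> k _; rewrite -expr2 sqr_ge0.
by move/allP/(_ j (mem_index_enum _)); rewrite /= -expr2 sqrf_eq0 => /eqP.
Qed.

(** Cauchy-Schwarz: expand the nonnegative square of [frob_norm Y *: X - frob_norm X *: Y] and
    cancel the product of the norms. The cancellation forces the separate treatment of a zero
    norm. *)
Lemma frob_inner_le m n (X Y : 'M[R]_(m, n)) :
  frob_inner X Y <= frob_norm X * frob_norm Y.
Proof.
have x0 := frob_norm_ge0 X; have y0 := frob_norm_ge0 Y.
have [xy0|xy0] := eqVneq (frob_norm X * frob_norm Y) 0.
  have /orP[/eqP/frob_norm0_eq->|/eqP/frob_norm0_eq->] :
    (frob_norm X == 0) || (frob_norm Y == 0) by rewrite -mulf_eq0 xy0.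
    rewrite -(scale0r X) frob_innerZl mul0r; exact: mulr_ge0 (frob_norm_ge0 _) _.
  rewrite -(scale0r Y) frob_innerZr mul0r; exact: mulr_ge0 _ (frob_norm_ge0 _).
have xy : 0 < frob_norm X * frob_norm Y by rewrite lt_neqAle eq_sym xy0 mulr_ge0.
have := frob_inner_ge0 (frob_norm Y *: X - frob_norm X *: Y).
rewrite !(frob_innerDl, frob_innerDr, frob_innerNl, frob_innerNr, frob_innerZl,
  frob_innerZr) -!frob_normE (frob_innerC Y X) => h.
rewrite -(ler_pM2l xy); lra.
Qed.

Lemma ler_frob_normD m n (X Y : 'M[R]_(m, n)) :
  frob_norm (X + Y) <= frob_norm X + frob_norm Y.
Proof.
rewrite frob_norm_leP ?addr_ge0 ?frob_norm_ge0//.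
rewrite frob_innerDl !frob_innerDr (frob_innerC Y X) -!frob_normE.
have := frob_inner_le X Y; nra.
Qed.

Lemma frob_normZ m n a (X : 'M[R]_(m, n)) :
  frob_norm (a *: X) = `|a| * frob_norm X.
Proof.
by rewrite /frob_norm frob_innerZl frob_innerZr mulrA -expr2 sqrtrM ?sqr_ge0//
  sqrtr_sqr.
Qed.

Lemma frob_normN m n (X : 'M[R]_(m, n)) : frob_norm (- X) = frob_norm X.
Proof. by rewrite -scaleN1r frob_normZ normrN1 mul1r. Qed.

Lemma frob_norm0 m n : frob_norm (0 : 'M[R]_(m, n)) = 0.
Proof. by rewrite -(scale0r 0) frob_normZ normr0 mul0r. Qed.

Lemma ler_frob_norm_sum m n (I : finType) (D : {set I}) (X : I -> 'M[R]_(m, n)) c :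
  (forall i, i \in D -> frob_norm (X i) <= c) ->
  frob_norm (\sum_(i in D) X i) <= #|D|%:R * c.
Proof.
move=> Xc; rewrite mulr_natl -sumr_const.
elim/big_rec2 : _ => [|i x y iD xy]; first by rewrite frob_norm0.
by apply: le_trans (ler_frob_normD _ _) _; rewrite lerD// Xc.
Qed.

Lemma frob_normT m n (X : 'M[R]_(m, n)) : frob_norm X^T = frob_norm X.
Proof.
rewrite /frob_norm /frob_inner exchange_big /=; congr Num.sqrt.
by apply: eq_bigr => i _; apply: eq_bigr => j _; rewrite !mxE.
Qed.

Lemma frob_innerT m n (X Y : 'M[R]_(m, n)) : frob_inner X^T Y^T = frob_inner X Y.
Proof.
rewrite /frob_inner exchange_big /=.
by apply: eq_bigr => i _; apply: eq_bigr => j _; rewrite !mxE.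
Qed.

(** Left multiplication by [Y] has left multiplication by [Y^T] as adjoint. With its right-hand
    counterpart below, this moves the factors off the sampled gradient and rewrites the alignment
    expressions as inner products with the mean gradient. *)
Lemma frob_inner_mulmxr m n p (X : 'M[R]_(m, p)) (Y : 'M[R]_(m, n)) (Z : 'M[R]_(n, p)) :
  frob_inner X (Y *m Z) = frob_inner (Y^T *m X) Z.
Proof.
transitivity (\sum_i \sum_j \sum_k X i j * Y i k * Z k j).
  do 2 (apply: eq_bigr => ? _); rewrite mxE mulr_sumr.
  by apply: eq_bigr => k _; rewrite mulrA.
rewrite /frob_inner.
under [RHS]eq_bigr do under eq_bigr do rewrite mxE mulr_suml.
under [LHS]eq_bigr do rewrite exchange_big /=.
rewrite [LHS]exchange_big /=; apply: eq_bigr => k _.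
rewrite exchange_big /=; apply: eq_bigr => j _; apply: eq_bigr => i _.
by rewrite mxE; ring.
Qed.

Lemma frob_inner_mulmxl m n p (X : 'M[R]_(m, p)) (Y : 'M[R]_(m, n)) (Z : 'M[R]_(n, p)) :
  frob_inner X (Y *m Z) = frob_inner (X *m Z^T) Y.
Proof.
by rewrite -frob_innerT trmx_mul frob_inner_mulmxr trmxK -frob_innerT trmx_mul
  !trmxK.
Qed.

(** Each entry of the product pairs a row of [X] with a column of [Y]; Cauchy-Schwarz on every
    entry, then summation. *)
Lemma ler_frob_normM m n p (X : 'M[R]_(m, n)) (Y : 'M[R]_(n, p)) :
  frob_norm (X *m Y) <= frob_norm X * frob_norm Y.
Proof.
rewrite frob_norm_leP ?mulr_ge0 ?frob_norm_ge0// exprMn !frob_normE.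
have -> : frob_inner Y Y = frob_inner Y^T Y^T by rewrite frob_innerT.
rewrite mulr_suml; apply: ler_sum => i _.
rewrite mulr_sumr; apply: ler_sum => j _.
have -> : (X *m Y) i j = frob_inner (row i X) (col j Y)^T.
  rewrite /frob_inner big_ord1 mxE; apply: eq_bigr => k _.
  by rewrite !mxE.
have -> : \sum_k X i k * X i k = frob_norm (row i X) ^+ 2.
  by rewrite frob_normE /frob_inner big_ord1; apply: eq_bigr => k _; rewrite !mxE.
have -> : \sum_k Y^T j k * Y^T j k = frob_norm (col j Y)^T ^+ 2.
  by rewrite frob_normE /frob_inner big_ord1; apply: eq_bigr => k _; rewrite !mxE.
set x := row i X; set y := (col j Y)^T.
have h1 := frob_inner_le x y; have h2 := frob_inner_le (- x) y.
rewrite frob_innerNl frob_normN in h2.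
by rewrite -exprMn -expr2 -real_normK ?num_real// ler_sqr ?nnegrE ?mulr_ge0//
  ?frob_norm_ge0// ler_norml h1 andbT lerNl.
Qed.

Lemma ler_frob_normM_bound m n p (X : 'M[R]_(m, n)) (Y : 'M[R]_(n, p)) x y :
  frob_norm X <= x -> frob_norm Y <= y -> frob_norm (X *m Y) <= x * y.
Proof.
move=> Xx Yy; apply: le_trans (ler_frob_normM _ _) _.
by rewrite ler_pM ?frob_norm_ge0.
Qed.

(** A local step moves the product of the factors by a sum of three matrices; this 3 is the one in
    the [3 * L] terms of [R_sel]. *)
Lemma frob_normD3_sqr m n (X Y Z : 'M[R]_(m, n)) :
  frob_norm (X + Y + Z) ^+ 2 <=
  3 * (frob_norm X ^+ 2 + frob_norm Y ^+ 2 + frob_norm Z ^+ 2).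
Proof.
have h : frob_norm (X + Y + Z) <= frob_norm X + frob_norm Y + frob_norm Z.
  by apply: le_trans (ler_frob_normD _ _) _; rewrite lerD2r ler_frob_normD.
have x0 := frob_norm_ge0 X; have y0 := frob_norm_ge0 Y.
have z0 := frob_norm_ge0 Z; have s0 := frob_norm_ge0 (X + Y + Z).
move: h x0 y0 z0 s0.
set s := frob_norm (_ + _); set x := frob_norm X; set y := frob_norm Y.
set z := frob_norm Z => h x0 y0 z0 s0.
apply: (@le_trans _ _ ((x + y + z) ^+ 2)); first by rewrite ler_sqr ?nnegrE//; lra.
have := sqr_ge0 (x - y); have := sqr_ge0 (x - z); have := sqr_ge0 (y - z); lra.
Qed.

(** Nonnegativity of the square of [a *: X - Y]. Taking [a] to be [etal] for selected and
    [rho * etal] for unselected clients produces the inverses in [R_sel] and [R_uns]. *)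
Lemma frob_inner_young m n (X Y : 'M[R]_(m, n)) a : 0 < a ->
  frob_inner X Y <= a / 2 * frob_norm X ^+ 2 + (2 * a)^-1 * frob_norm Y ^+ 2.
Proof.
move=> a0; have := frob_inner_ge0 (a *: X - Y).
rewrite !(frob_innerDl, frob_innerDr, frob_innerNl, frob_innerNr, frob_innerZl,
  frob_innerZr) (frob_innerC Y X) -!frob_normE => h.
rewrite -(ler_pM2l (mulr_gt0 (ltr0n _ 2) a0)) mulrDr !mulrA.
rewrite mulfV ?mulf_neq0 ?gt_eqF// mul1r.
by apply: (@le_trans _ _ (a * a * frob_norm X ^+ 2 + frob_norm Y ^+ 2)); lra.
Qed.

Lemma ler_mx_entry_frob_norm m n (X : 'M[R]_(m, n)) i j : `|X i j| <= frob_norm X.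
Proof.
rewrite -sqrtr_sqr ler_wsqrtr// /frob_inner (bigD1 i)//= (bigD1 j)//= -expr2.
rewrite -addrA lerDl addr_ge0//; first by apply: sumr_ge0 => k _; rewrite -expr2 sqr_ge0.
by do 2 (apply: sumr_ge0 => ? _); rewrite -expr2 sqr_ge0.
Qed.

End frobenius.

(** * Measurability of matrix-valued functions *)

Section matrix_measurability.
Context {R : realType}.

(* Matrices carry no canonical sigma-algebra, so measurability is tracked
   entrywise; [measurable_mx_borel] and [borel_measurable_mx] relate this to
   the Borel sigma-algebra. *)
Definition measurable_mx d (T : measurableType d) m n (X : T -> 'M[R]_(m, n)) :=
  forall i j, measurable_fun setT (fun w => X w i j).

(** The numerator 2 leaves room for two errors below [k.+1%:R^-1]: from [M] to a rational centre,
    and from that centre to a point of its box. *)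
Lemma open_entrywise m n (O : set 'M[R]_(m, n)) (M : 'M[R]_(m, n)) :
  open O -> O M -> exists k : nat,
    [set N : 'M[R]_(m, n) | forall i j, `|M i j - N i j| < 2 / k.+1%:R] `<=` O.
Proof.
move=> oO OM; have [e /= e0 eO] : nbhs_ball M O by apply/nbhs_ballP/open_nbhs_nbhs.
have [k _ /(_ k (leqnn k))/=] := near_infty_natSinv_lt (PosNum (divr_gt0 e0 (ltr0n R 2))).
rewrite [ltRHS]/= => ke; exists k => N /= MN; apply: eO; split => // i j.
apply: lt_le_trans (MN i j) _; by move: ke => /=; rewrite ltr_pdivlMr// mulrC => /ltW.
Qed.

Lemma measurable_mx_borel d (T : measurableType d) m n (X : T -> 'M[R]_(m, n)) :
  measurable_mx X -> measurable_fun setT (X : T -> borel_mx R m n).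
Proof.
move=> mX; apply: (@measurability _ _ T (borel_mx R m n) setT X (@open 'M[R]_(m, n))) => //.
move=> _ [V oV <-]; rewrite setTI.
(* Boxes with a rational centre and an inverse integer as radius are countably many. An open set is
   the union of those it contains, and the preimage of a box is a finite intersection of entrywise
   conditions. *)
pose box (qk : 'M[rat]_(m, n) * nat) : set 'M[R]_(m, n) :=
  [set N | forall i j, `|ratr (qk.1 i j) - N i j| < qk.2.+1%:R^-1].
have -> : X @^-1` V = \bigcup_qk
    (if `[< box qk `<=` V >] then X @^-1` box qk else set0).
  apply/seteqP; split => [w /= Vw|w [qk _]]; last by case: asboolP => // bV /= /bV.
  have [k kV] := open_entrywise oV Vw.
  have /choice[q qP] (ij : 'I_m * 'I_n) : exists q : rat,
      ratr q \in `]X w ij.1 ij.2 - k.+1%:R^-1, X w ij.1 ij.2 + k.+1%:R^-1[.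
    by apply: rat_in_itvoo; rewrite ltrBlDr -addrA ltrDl addr_gt0 ?invr_gt0 ?ltr0n.
  have qX i j : `|ratr (q (i, j)) - X w i j| < k.+1%:R^-1.
    by have := qP (i, j); rewrite in_itv /= ltr_distl.
  exists (\matrix_(i, j) q (i, j), k) => //; case: asboolP => [_ i j|[]].
    by rewrite mxE /= qX.
  move=> N /= NX; apply: kV => i j /=; have := NX i j; rewrite mxE /= => {}NX.
  rewrite -[X w i j - N i j](subrKA (ratr (q (i, j)))).
  rewrite (le_lt_trans (ler_normD _ _))// (_ : 2 / _ = k.+1%:R^-1 + k.+1%:R^-1).
    by rewrite ltrD// distrC qX.
  by rewrite mulr_natl mulr2n.
apply: countable_bigcupT_measurable => [|qk]; first exact: countableP.
case: ifP => _ //.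
have -> : X @^-1` box qk = \bigcap_(ij in [set: 'I_m * 'I_n])
    [set w | `|ratr (qk.1 ij.1 ij.2) - X w ij.1 ij.2| < qk.2.+1%:R^-1].
  apply/seteqP; split => [w h [i j] _|w h i j] /=; first exact: h.
  exact: (h (i, j)).
apply: fin_bigcap_measurable => [|ij _]; first exact: finite_finset.
rewrite -[X in measurable X]setTI.
have : measurable_fun setT
    (fun w => `|ratr (qk.1 ij.1 ij.2) - X w ij.1 ij.2| < qk.2.+1%:R^-1).
  apply: measurable_fun_ltr => //; apply: measurableT_comp => //.
  exact: measurable_funB.
by move=> /(_ measurableT [set true]); exact.
Qed.

Lemma continuous_borel_measurable m n (f : 'M[R]_(m, n) -> R) :
  continuous f -> measurable_fun setT (f : borel_mx R m n -> R).
Proof.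
move=> cf; apply: (measurability _ (RGenOpens.measurableE R)).
move=> _ [_ [a [b ->]] <-]; rewrite setTI.
apply: sub_sigma_algebra; apply: open_comp => // x _; exact: cf.
Qed.

Lemma borel_measurable_mx d (T : measurableType d) m n (X : T -> 'M[R]_(m, n)) :
  measurable_fun setT (X : T -> borel_mx R m n) -> measurable_mx X.
Proof.
move=> mX i j; apply: (measurableT_comp (f := fun M : borel_mx R m n => M i j)) => //.
apply: continuous_borel_measurable; exact: coord_continuous.
Qed.

End matrix_measurability.

Section measurable_mx_theory.
Context {R : realType} d (T : measurableType d).
Implicit Types m n p : nat.

Lemma measurable_mx_cst m n (M : 'M[R]_(m, n)) : measurable_mx (fun _ : T => M).
Proof. by move=> i j; exact: measurable_cst. Qed.

Lemma measurable_mxD m n (X Y : T -> 'M[R]_(m, n)) :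
  measurable_mx X -> measurable_mx Y -> measurable_mx (fun w => X w + Y w).
Proof.
move=> mX mY i j; under eq_fun do rewrite mxE; exact: measurable_funD.
Qed.

Lemma measurable_mxN m n (X : T -> 'M[R]_(m, n)) :
  measurable_mx X -> measurable_mx (fun w => - X w).
Proof.
by move=> mX i j; under eq_fun do rewrite mxE; exact: measurableT_comp.
Qed.

Lemma measurable_mxZ m n a (X : T -> 'M[R]_(m, n)) :
  measurable_mx X -> measurable_mx (fun w => a *: X w).
Proof.
move=> mX i j; under eq_fun do rewrite mxE; exact: measurable_funM.
Qed.

Lemma measurable_mxM m n p (X : T -> 'M[R]_(m, n)) (Y : T -> 'M[R]_(n, p)) :
  measurable_mx X -> measurable_mx Y -> measurable_mx (fun w => X w *m Y w).
Proof.
move=> mX mY i j; under eq_fun do rewrite mxE.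
by apply: measurable_sum => k; exact: measurable_funM.
Qed.

Lemma measurable_mxT m n (X : T -> 'M[R]_(m, n)) :
  measurable_mx X -> measurable_mx (fun w => (X w)^T).
Proof. by move=> mX i j; under eq_fun do rewrite mxE; exact: mX. Qed.

Lemma measurable_mx_sum m n (I : finType) (D : {set I}) (X : I -> T -> 'M[R]_(m, n)) :
  (forall k, measurable_mx (X k)) -> measurable_mx (fun w => \sum_(k in D) X k w).
Proof.
move=> mX i j; under eq_fun do rewrite summxE -big_filter.
by apply: measurable_sum => k; exact: mX.
Qed.

Lemma measurable_continuous_mx m n (f : 'M[R]_(m, n) -> R) (X : T -> 'M[R]_(m, n)) :
  continuous f -> measurable_mx X -> measurable_fun setT (f \o X).
Proof.
move=> cf mX.
apply: (measurableT_comp (f := f : borel_mx R m n -> R)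
  (g := X : T -> borel_mx R m n)).
  exact: continuous_borel_measurable.
exact: measurable_mx_borel.
Qed.

End measurable_mx_theory.

(** * Measurability and local boundedness of a smooth function and its gradient *)

Section smooth_functions.
Context {R : realType} m n (L : R) (f : 'M[R]_(m, n) -> R).
Hypothesis fL : smooth L f.

Lemma smooth_continuous : continuous f.
Proof. by move=> U; apply: differentiable_continuous; exact: fL.1. Qed.

(** Each partial derivative is the pointwise limit of the difference quotients with steps
    [k.+1%:R^-1], and these are measurable because [f] is continuous. *)
Lemma measurable_grad d (T : measurableType d) (X : T -> 'M[R]_(m, n)) :
  measurable_mx X -> measurable_mx (fun w => grad f (X w)).
Proof.
move=> mX i j; under eq_fun do rewrite mxE.
pose h (k : nat) w : R :=
  k.+1%:R * (f (k.+1%:R^-1 *: delta_mx i j + X w) - f (X w)).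
apply: (@measurable_fun_cvg _ _ _ _ h) => [k|w _].
  apply: measurable_funM => //; apply: measurable_funB.
    apply: (measurable_continuous_mx smooth_continuous).
    by apply: measurable_mxD mX; exact: measurable_mx_cst.
  exact: (measurable_continuous_mx smooth_continuous).
have /cvg_ex[l lP] : derivable f (X w) (delta_mx i j).
  by apply: diff_derivable; exact: fL.1.
have -> : 'D_(delta_mx i j) f (X w) = l by exact: cvg_lim lP.
(* The derivative is a limit over punctured neighbourhoods of 0, so the steps must tend to 0 while
   avoiding it. *)
have inv_cvg : harmonic x @[x --> \oo] --> (0 : R)^'.
  apply: cvg_trans (_ : _ --> within (fun x : R => x != 0) (nbhs 0)) => //.
  move=> A /= [e e0 eA]; have := @cvg_harmonic R.
  move=> /(_ _ (nbhsx_ballx _ _ e0)) [N _ NP]; exists N => // k Nk /=.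
  by have := eA _ (NP _ Nk); apply; rewrite invr_neq0.
have := cvg_comp _ _ inv_cvg lP; apply: cvg_trans.
apply: near_eq_cvg; apply: nearW => k /=.
by rewrite invrK /h.
Qed.

(** The ball lies in the cube of matrices with entries in [[- C, C]]. Read as row vectors, this cube
    is a product of segments, hence compact, and [f] is continuous. *)
Lemma bounded_on_frob_ball (C : R) : exists M : R,
  forall U, frob_norm U <= C -> `|f U| <= M.
Proof.
have cvec : continuous (vec_mx : 'rV[R]_(m * n) -> 'M[R]_(m, n)).
  move=> v A /nbhs_ballP[e /= e0 eA]; apply/nbhs_ballP; exists e => // u [_ vu].
  by apply: eA; split => // i j; rewrite !mxE; exact: vu.
have cpt : compact [set v : 'rV[R]_(m * n) | forall k, `[- C, C]%classic (v ord0 k)].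
  by apply: (rV_compact (A := fun=> `[- C, C]%classic)) => _; exact: segment_compact.
have /compact_bounded[M [_ MP]] :
    compact ((f \o vec_mx) @` [set v : 'rV[R]_(m * n) |
      forall k, `[- C, C]%classic (v ord0 k)]).
  apply: continuous_compact => //; apply: continuous_subspaceT => v.
  by apply: continuous_comp; [exact: cvec|exact: smooth_continuous].
exists (M + 1) => U UC; apply: (MP (M + 1)); first by rewrite ltrDl.
exists (mxvec U) => /=; last by rewrite mxvecK.
move=> k; case/mxvec_indexP: k => i j; rewrite mxvecE /= in_itv /= -ler_norml.
exact: le_trans (ler_mx_entry_frob_norm _ _ _) UC.
Qed.

(* Moving from U against a unit multiple of the gradient stays in a slightly
   larger ball, so the descent inequality turns a bound on f into one on its
   gradient. *)
Lemma grad_bounded_on_frob_ball (C : R) : exists M : R,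
  forall U, frob_norm U <= C -> frob_norm (grad f U) <= M.
Proof.
have [M MP] := bounded_on_frob_ball (C + 1).
exists (M + M + `|L| / 2) => U UC; have := frob_norm_ge0 (grad f U).
rewrite le_eqVlt => /predU1P[<-|g0].
  have M0 : 0 <= M by apply: le_trans (MP U _); [exact: normr_ge0|lra].
  by rewrite !addr_ge0// mulr_ge0.
set g := grad f U in g0 *.
pose D := - (frob_norm g)^-1 *: g.
have D1 : frob_norm D = 1.
  by rewrite frob_normZ normrN normfV ger0_norm ?mulVf ?gt_eqF// ltW.
have := fL.2 U (U + D).
rewrite [U + D - U]addrC addKr D1 expr1n mulr1 frob_innerZr -frob_normE expr2.
rewrite mulNr mulrA mulVf ?gt_eqF// mul1r.
have : `|f U| <= M by apply: MP; lra.
have : `|f (U + D)| <= M.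
  by apply: MP; apply: le_trans (ler_frob_normD _ _) _; rewrite D1 lerD2r.
rewrite !ler_norml => /andP[? _] /andP[_ ?]; have := ler_norm L; lra.
Qed.

End smooth_functions.

(** * Independence and conditional expectation *)

Section independence.
Local Open Scope ereal_scope.
Context d d1 d2 (T : measurableType d) (S1 : measurableType d1)
  (S2 : measurableType d2) (R : realType) (P : probability T R).
Context (X : {RV P >-> S1}) (Y : {RV P >-> S2}).
Hypothesis XY : independent P X Y.
Variable phi : S1 * S2 -> \bar R.
Hypothesis mphi : measurable_fun setT phi.
Hypothesis iphi : P.-integrable setT (fun w => phi (X w, Y w)).

Let mXY : measurable_fun setT (fun w => (X w, Y w)).
Proof. exact: measurable_fun_pair. Qed.

Let XYE A : measurable A ->
  (distribution P X \x distribution P Y) A = pushforward P (fun w => (X w, Y w)) A.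
Proof.
pose Z : {RV P >-> (S1 * S2)%type} := mfun_Sub (mem_set mXY).
by move=> mA; apply: (@product_measure_unique _ _ _ _ _ (distribution P X)
  (distribution P Y) (distribution P Z)) => // B C mB mC; exact: XY.
Qed.

Lemma independent_integrable :
  (distribution P X \x distribution P Y).-integrable setT phi.
Proof.
have /integrableP[_ h] := integrable_pushforward mXY mphi iphi measurableT.
apply/integrableP; split => //; apply: le_lt_trans h.
by rewrite (eq_measure_integral (pushforward P (fun w => (X w, Y w))))// => A mA _;
  exact: XYE.
Qed.

(** By independence the joint law of [X] and [Y] is the product of their laws ([XYE]); the rest is
    Fubini. *)
Lemma independent_integral :
  \int[P]_w phi (X w, Y w) =
  \int[distribution P X]_a \int[distribution P Y]_b phi (a, b).
Proof.
rewrite [RHS](integral12_prod_meas1 independent_integrable).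
rewrite (@eq_measure_integral _ _ _ _ (pushforward P (fun w => (X w, Y w)))).
  by rewrite integral_pushforward.
by move=> A mA _; exact: XYE.
Qed.

End independence.

Section conditional_expectation.
Local Open Scope ereal_scope.
Context d d0 d1 d2 (T : measurableType d) (S0 : measurableType d0)
  (S1 : measurableType d1) (S2 : measurableType d2) (R : realType)
  (P : probability T R).
Context (X : {RV P >-> S0}) (Y : {RV P >-> S2}).
Variables (u : S0 -> S1) (q : S1 * S2 -> R) (gamma : S1 -> R).
Hypothesis XY : independent P X Y.
Hypothesis mu : measurable_fun setT u.
Hypothesis mq : measurable_fun setT q.
Hypothesis mgamma : measurable_fun setT gamma.
Hypothesis condE : is_cond_expectation P (u \o X)
  (fun w => q (u (X w), Y w)) (fun w => gamma (u (X w))).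

Let muX : measurable_fun setT (u \o X). Proof. exact: measurableT_comp. Qed.

Let V : {RV P >-> S1} := mfun_Sub (mem_set muX).

Let VY : independent P V Y.
Proof.
move=> D1 D2 mD1 mD2; apply: (XY (D1 := u @^-1` D1)) => //.
by rewrite -[X in measurable X]setTI; exact: mu.
Qed.

Let h s := \int[distribution P Y]_y (q (s, y))%:E.

Let hq : P.-integrable setT (fun w => (q (V w, Y w))%:E).
Proof. by case: condE. Qed.

Let hgamma : P.-integrable setT (fun w => (gamma (V w))%:E).
Proof. by case: condE. Qed.

Let mqE : measurable_fun setT (EFin \o q). Proof. exact/measurable_EFinP. Qed.

Let mgammaE : measurable_fun setT (EFin \o gamma).
Proof. exact/measurable_EFinP. Qed.

Let mh : measurable_fun setT h.
Proof. exact: (measurable_fubini_F (independent_integrable VY mqE hq)). Qed.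

(** Since [Y] is independent of [u \o X], averaging [q] over the law of [Y] alone yields a function
    [h] with the same integral as [gamma] over every measurable set, for the law of [u \o X]. *)
Lemma cond_expectation_fiber : ae_eq (distribution P V) setT (EFin \o gamma) h.
Proof.
apply: integral_ae_eq => //; first exact: integrable_pushforward.
move=> D _ mD.
have mVD : measurable (V @^-1` D) by rewrite -[X in measurable X]setTI; exact: muX.
have mDT : measurable (D `*` [set: S2]) by exact: measurableX.
rewrite integral_pushforward//; last exact: integrableS hgamma.
transitivity (\int[P]_(w in V @^-1` D) (q (V w, Y w))%:E).
  by case: condE => _ _ _ /(_ _ mD).
rewrite [LHS]integral_mkcond [RHS]integral_mkcond.
pose phi := (EFin \o q) \_ (D `*` [set: S2]).
have mphi : measurable_fun setT phi.
  by apply/(measurable_restrictT _ mDT); exact: measurable_funTS.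
have phiE w : ((fun w => (q (V w, Y w))%:E) \_ (V @^-1` D)) w = phi (V w, Y w).
  rewrite /phi !patchE /=; congr (if _ then _ else _).
  by apply/idP/idP; rewrite !inE => // -[].
under eq_integral do rewrite phiE.
rewrite (independent_integral VY mphi); last first.
  apply: (eq_integrable _ _ _ (fun w _ => phiE w)) => //.
  by apply/integrable_restrict => //; rewrite setTI; exact: integrableS hq.
apply: eq_integral => s _; rewrite patchE /h /phi.
case: ifPn => sD; last first.
  rewrite integral0_eq// => y _; rewrite patchE ifN//.
  by apply: contra sD; rewrite !inE => -[].
by apply: eq_integral => y _; rewrite patchE mem_set//; split => //; exact: set_mem.
Qed.

(* Y being independent of the whole of X, the conditional expectation given
   u X is also the one given X. *)
Lemma cond_expectation_weighted (psi : S0 -> R) :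
  measurable_fun setT psi ->
  P.-integrable setT (fun w => (psi (X w) * q (u (X w), Y w))%:E) ->
  P.-integrable setT (fun w => (psi (X w) * gamma (u (X w)))%:E) ->
  \int[P]_w (psi (X w) * q (u (X w), Y w))%:E =
  \int[P]_w (psi (X w) * gamma (u (X w)))%:E.
Proof.
move=> mpsi iq igamma.
pose phi (ab : S0 * S2) := (psi ab.1 * q (u ab.1, ab.2))%:E.
have mqu : measurable_fun setT (fun ab : S0 * S2 => q (u ab.1, ab.2)).
  apply: (measurableT_comp (f := q)) => //; apply: measurable_fun_pair => //.
  exact: measurableT_comp.
have mphi : measurable_fun setT phi.
  by apply/measurable_EFinP; apply: measurable_funM => //; exact: measurableT_comp.
have iphi := independent_integrable XY mphi iq.
rewrite (independent_integral XY mphi iq) /=.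
have mpg : measurable_fun setT (fun a => (psi a * gamma (u a))%:E).
  apply/measurable_EFinP; apply: measurable_funM => //; exact: measurableT_comp.
transitivity (\int[distribution P X]_a (psi a * gamma (u a))%:E); last first.
  exact: integral_distribution.
apply: ae_eq_integral => //; first exact: (measurable_fubini_F iphi).
have iqu : P.-integrable setT (fun w => (fun ab => (q (u ab.1, ab.2))%:E) (X w, Y w)).
  exact: hq.
have mquE : measurable_fun setT (fun ab : S0 * S2 => (q (u ab.1, ab.2))%:E).
  exact/measurable_EFinP.
have ae1 := ae_integrable1 (independent_integrable XY mquE iqu).
have [N [mN N0 hN]] := cond_expectation_fiber.
(* A null set for the law of [u \o X] pulls back along [u] to a null set for the law of [X]: both
   measures are the probability of the same event. *)
have ae2 : \forall a \ae distribution P X, (gamma (u a))%:E = h (u a).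
  exists (u @^-1` N); split => //; first by rewrite -[X in measurable X]setTI; exact: mu.
  by move=> a /= ha; apply: hN => /=; apply: contra_not ha; apply.
apply: filterS2 ae1 ae2 => a ia ga _ /=.
rewrite /fubini_F /phi /=; under eq_integral do rewrite EFinM.
by rewrite integralZl// EFinM ga.
Qed.

End conditional_expectation.

(** * Essentially bounded random variables *)

Section ae_bounded.
Context d (T : measurableType d) (R : realType) (P : probability T R).
Implicit Types X Y : T -> R.

(** Unlike integrability, essential boundedness is stable under products, so inner products and
    squared norms of the iterates stay in one class where integrals split freely. *)
Definition ae_bounded X :=
  measurable_fun setT X /\ exists M, {ae P, forall w, `|X w| <= M}.

Lemma ae_bounded_integrable X : ae_bounded X -> P.-integrable setT (EFin \o X).
Proof.
move=> [mX [M XM]]; apply/integrableP; split; first exact/measurable_EFinP.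
apply: le_lt_trans (integral_le_bound `|M|%:E _ _ _ _) _ => //.
- exact/measurable_EFinP.
- by apply: filterS XM => w XMw _; rewrite lee_fin (le_trans XMw)// ler_norm.
- by rewrite [X in (_ * X)%E](_ : _ = 1%E) ?mule1 ?ltry//; exact: probability_setT.
Qed.

Lemma ae_bounded_cst c : ae_bounded (fun=> c).
Proof. by split => //; exists `|c|; exact: aeW. Qed.

Lemma ae_boundedD X Y :
  ae_bounded X -> ae_bounded Y -> ae_bounded (fun w => X w + Y w).
Proof.
move=> [mX [M XM]] [mY [N YN]]; split; first exact: measurable_funD.
exists (M + N); apply: filterS2 XM YN => w XM YN.
by rewrite (le_trans (ler_normD _ _))// lerD.
Qed.

Lemma ae_boundedM X Y :
  ae_bounded X -> ae_bounded Y -> ae_bounded (fun w => X w * Y w).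
Proof.
move=> [mX [M XM]] [mY [N YN]]; split; first exact: measurable_funM.
exists (M * N); apply: filterS2 XM YN => w XM YN.
by rewrite normrM ler_pM.
Qed.

Lemma ae_boundedZ c X : ae_bounded X -> ae_bounded (fun w => c * X w).
Proof. by apply: ae_boundedM; exact: ae_bounded_cst. Qed.

Lemma ae_bounded_sum (I : Type) (s : seq I) (X : I -> T -> R) :
  (forall i, ae_bounded (X i)) -> ae_bounded (fun w => \sum_(i <- s) X i w).
Proof.
move=> bX; elim: s => [|i s IHs].
  by under eq_fun do rewrite big_nil; exact: ae_bounded_cst.
by under eq_fun do rewrite big_cons; exact: ae_boundedD.
Qed.

Lemma Rintegral_ae_boundedD X Y : ae_bounded X -> ae_bounded Y ->
  \int[P]_w (X w + Y w) = \int[P]_w X w + \int[P]_w Y w.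
Proof. by move=> bX bY; rewrite RintegralD//; exact: ae_bounded_integrable. Qed.

Lemma Rintegral_ae_boundedZ c X : ae_bounded X ->
  \int[P]_w (c * X w) = c * \int[P]_w X w.
Proof. by move=> bX; rewrite RintegralZl//; exact: ae_bounded_integrable. Qed.

Lemma Rintegral_probability_cst c : \int[P]_w c = c :> R.
Proof.
by rewrite Rintegral_cst// [X in fine X](_ : _ = 1%E) ?mulr1//; exact: probability_setT.
Qed.

Lemma Rintegral_ae_bounded_sum (I : Type) (s : seq I) (X : I -> T -> R) :
  (forall i, ae_bounded (X i)) ->
  \int[P]_w (\sum_(i <- s) X i w) = \sum_(i <- s) \int[P]_w X i w.
Proof.
move=> bX; elim: s => [|i s IHs].
  rewrite big_nil; under eq_Rintegral do rewrite big_nil.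
  exact: Rintegral_probability_cst.
rewrite big_cons -IHs -Rintegral_ae_boundedD//; last exact: ae_bounded_sum.
by apply: eq_Rintegral => w _; rewrite big_cons.
Qed.

(** Replacing [X] by [Num.min X Y], which equals it almost everywhere, makes the inequality hold at
    every point. *)
Lemma ae_le_Rintegral X Y : ae_bounded X -> ae_bounded Y ->
  {ae P, forall w, X w <= Y w} -> \int[P]_w X w <= \int[P]_w Y w.
Proof.
move=> bX bY XY; pose Z w := Num.min (X w) (Y w).
have bZ : ae_bounded Z.
  split; first by apply: measurable_minr; [case: bX|case: bY].
  case: bX => _ [M XM]; exists M; apply: filterS2 XM XY => w XM XY.
  by rewrite /Z min_l.
suff -> : \int[P]_w X w = \int[P]_w Z w.
  apply: le_Rintegral => //; [exact: ae_bounded_integrable..|].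
  by move=> w _; rewrite /Z ge_min lexx orbT.
congr fine; apply: ae_eq_integral => //.
- by case: bX => mX _; exact/measurable_EFinP.
- by case: bZ => mZ _; exact/measurable_EFinP.
- by apply: filterS XY => w XY _; rewrite /Z min_l.
Qed.

Definition ae_bounded_mx m n (X : T -> 'M[R]_(m, n)) :=
  measurable_mx X /\ exists M, {ae P, forall w, frob_norm (X w) <= M}.

Lemma ae_bounded_mxD m n (X Y : T -> 'M[R]_(m, n)) :
  ae_bounded_mx X -> ae_bounded_mx Y -> ae_bounded_mx (fun w => X w + Y w).
Proof.
move=> [mX [M XM]] [mY [N YN]]; split; first exact: measurable_mxD.
exists (M + N); apply: filterS2 XM YN => w XM YN.
by rewrite (le_trans (ler_frob_normD _ _))// lerD.
Qed.

Lemma ae_bounded_mxN m n (X : T -> 'M[R]_(m, n)) :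
  ae_bounded_mx X -> ae_bounded_mx (fun w => - X w).
Proof.
move=> [mX [M XM]]; split; first exact: measurable_mxN.
by exists M; apply: filterS XM => w; rewrite frob_normN.
Qed.

Lemma ae_bounded_mxM m n p (X : T -> 'M[R]_(m, n)) (Y : T -> 'M[R]_(n, p)) :
  ae_bounded_mx X -> ae_bounded_mx Y -> ae_bounded_mx (fun w => X w *m Y w).
Proof.
move=> [mX [M XM]] [mY [N YN]]; split; first exact: measurable_mxM.
exists (M * N); apply: filterS2 XM YN => w.
exact: ler_frob_normM_bound.
Qed.

Lemma ae_bounded_mxT m n (X : T -> 'M[R]_(m, n)) :
  ae_bounded_mx X -> ae_bounded_mx (fun w => (X w)^T).
Proof.
move=> [mX [M XM]]; split; first exact: measurable_mxT.
by exists M; apply: filterS XM => w; rewrite frob_normT.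
Qed.

Lemma ae_bounded_mx_entry m n (X : T -> 'M[R]_(m, n)) i j :
  ae_bounded_mx X -> ae_bounded (fun w => X w i j).
Proof.
move=> [mX [M XM]]; split => //; exists M; apply: filterS XM => w.
exact: le_trans (ler_mx_entry_frob_norm _ _ _).
Qed.

Lemma ae_bounded_frob_inner m n (X Y : T -> 'M[R]_(m, n)) :
  ae_bounded_mx X -> ae_bounded_mx Y ->
  ae_bounded (fun w => frob_inner (X w) (Y w)).
Proof.
move=> bX bY; do 2 (apply: ae_bounded_sum => ?).
by apply: ae_boundedM; exact: ae_bounded_mx_entry.
Qed.

Lemma ae_bounded_frob_norm_sqr m n (X : T -> 'M[R]_(m, n)) :
  ae_bounded_mx X -> ae_bounded (fun w => frob_norm (X w) ^+ 2).
Proof.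
by move=> bX; under eq_fun do rewrite frob_normE; exact: ae_bounded_frob_inner.
Qed.

Lemma ae_bounded_smooth m n (L : R) (f : 'M[R]_(m, n) -> R) (X : T -> 'M[R]_(m, n)) :
  smooth L f -> ae_bounded_mx X -> ae_bounded (f \o X).
Proof.
move=> fL [mX [C XC]]; split.
  exact: measurable_continuous_mx (smooth_continuous fL) mX.
have [M MP] := bounded_on_frob_ball fL C; exists M.
by apply: filterS XC => w; exact: MP.
Qed.

Lemma ae_bounded_grad m n (L : R) (f : 'M[R]_(m, n) -> R) (X : T -> 'M[R]_(m, n)) :
  smooth L f -> ae_bounded_mx X -> ae_bounded_mx (fun w => grad f (X w)).
Proof.
move=> fL [mX [C XC]]; split; first exact: (measurable_grad fL mX).
have [M MP] := grad_bounded_on_frob_ball fL C; exists M.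
by apply: filterS XC => w; exact: MP.
Qed.

End ae_bounded.

(** Entrywise use of [cond_expectation_weighted]. The weight [W] is a function of the whole of [X],
    so it may involve the two factors separately although the conditioning is on [u (X w)] only. *)
Lemma frob_inner_cond_expectation d d0 d2 (T : measurableType d)
  (S0 : measurableType d0) (S2 : measurableType d2) (R : realType)
  (P : probability T R) (X : {RV P >-> S0}) (Y : {RV P >-> S2}) m n
  (u : S0 -> 'M[R]_(m, n)) (q : 'M[R]_(m, n) -> S2 -> 'M[R]_(m, n))
  (gamma : 'M[R]_(m, n) -> 'M[R]_(m, n)) (W : S0 -> 'M[R]_(m, n)) :
  independent P X Y -> measurable_mx u ->
  measurable_fun [set: borel_mx R m n * S2]
    (fun ux : borel_mx R m n * S2 => q ux.1 ux.2 : borel_mx R m n) ->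
  measurable_mx (gamma : borel_mx R m n -> 'M[R]_(m, n)) ->
  is_mx_cond_expectation P (fun w => u (X w) : borel_mx R m n)
    (fun w => q (u (X w)) (Y w)) (fun w => gamma (u (X w))) ->
  measurable_mx W -> ae_bounded_mx P (fun w => W (X w)) ->
  ae_bounded_mx P (fun w => q (u (X w)) (Y w)) ->
  ae_bounded_mx P (fun w => gamma (u (X w))) ->
  \int[P]_w frob_inner (W (X w)) (q (u (X w)) (Y w)) =
  \int[P]_w frob_inner (W (X w)) (gamma (u (X w))).
Proof.
move=> XY mu mq mgamma condE mW bW bq bgamma.
have mq' : measurable_mx (fun ux : borel_mx R m n * S2 => q ux.1 ux.2).
  exact: borel_measurable_mx.
have sumE Z : ae_bounded_mx P Z -> \int[P]_w frob_inner (W (X w)) (Z w) =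
    \sum_i \sum_j \int[P]_w (W (X w) i j * Z w i j).
  move=> bZ; have bWZ i j : ae_bounded P (fun w => W (X w) i j * Z w i j).
    by apply: ae_boundedM; exact: ae_bounded_mx_entry.
  rewrite Rintegral_ae_bounded_sum => [|i]; last exact: ae_bounded_sum.
  by apply: eq_bigr => i _; rewrite Rintegral_ae_bounded_sum.
rewrite !sumE//; apply: eq_bigr => i _; apply: eq_bigr => j _; congr fine.
apply: (cond_expectation_weighted (u := u : S0 -> borel_mx R m n)
  (q := fun ux => q ux.1 ux.2 i j) (gamma := fun U => gamma U i j) XY _ _ _ _
  (psi := fun a => W a i j)) => //.
- exact: measurable_mx_borel.
- by apply: ae_bounded_integrable; apply: ae_boundedM; exact: ae_bounded_mx_entry.
- by apply: ae_bounded_integrable; apply: ae_boundedM; exact: ae_bounded_mx_entry.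
Qed.

(** * Iterates of the procedure *)

Section local_training.
Context (R : realType) (dout din r N : nat) (Xi : Type).
Variables (etal : R) (g : 'I_N -> 'M[R]_(dout, din) -> Xi -> 'M[R]_(dout, din)).
Variables (i : 'I_N) (z : nat -> Xi) (AB : factors R dout din r).
Hypothesis etal0 : 0 <= etal.

Let run e := local_run etal g i z AB e.
Let G e := g i (update (run e)) (z e).

Lemma update_local_step e :
  update (run e.+1) - update (run e) =
  - etal *: ((run e).2 *m (run e).2^T *m G e)
  - etal *: (G e *m (run e).1^T *m (run e).1)
  + etal ^+ 2 *: (G e *m (run e).1^T *m (run e).2^T *m G e).
Proof.
rewrite {1}/update [run e.+1]/run /= -/(run e) -/(G e).
rewrite mulmxBl !mulmxBr -!scalemxAl -!scalemxAr !mulmxA scalerA -expr2.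
set a := etal *: _; set b := etal *: _; set c := _ ^+ 2 *: _.
rewrite /update scaleNr -/a; set X := (run e).2 *m _.
by rewrite -(addrA X) (addrC X) addrK opprB (addrC c) addrA.
Qed.

(** One step moves the first factor by the second factor times a gradient, whence [CB]. The starting
    index is free because both the drift over a round ([e0 = 0]) and over its last step
    ([e0 = E.-1]) are used. *)
Lemma local_drift1 CB Gmax e0 e : (e0 <= e)%N -> 0 <= CB ->
  (forall e', (e' < e)%N -> frob_norm (run e').2 <= CB) ->
  (forall e', (e' < e)%N -> frob_norm (G e') <= Gmax) ->
  frob_norm ((run e).1 - (run e0).1) <= (e - e0)%:R * (etal * CB * Gmax).
Proof.
move=> + CB0; elim: e => [|e IHe] e0e hB hG.
  by move: e0e; rewrite leqn0 => /eqP->; rewrite subrr frob_norm0 subnn mul0r.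
move: e0e; rewrite leq_eqVlt => /predU1P[->|].
  by rewrite subrr frob_norm0 subnn mul0r.
rewrite ltnS => e0e; rewrite subSn// -natr1 mulrDl mul1r.
rewrite [run e.+1]/run /= -/(run e) -/(G e) addrAC.
apply: le_trans (ler_frob_normD _ _) _; apply: lerD.
  by apply: IHe => // e' e'e; [apply: hB|apply: hG]; exact: ltnW.
rewrite frob_normN frob_normZ ger0_norm// -mulrA ler_wpM2l//.
by apply: ler_frob_normM_bound; rewrite ?frob_normT ?hB ?hG.
Qed.

Lemma local_drift2 CA Gmax e0 e : (e0 <= e)%N -> 0 <= CA ->
  (forall e', (e' < e)%N -> frob_norm (run e').1 <= CA) ->
  (forall e', (e' < e)%N -> frob_norm (G e') <= Gmax) ->
  frob_norm ((run e).2 - (run e0).2) <= (e - e0)%:R * (etal * CA * Gmax).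
Proof.
move=> + CA0; elim: e => [|e IHe] e0e hA hG.
  by move: e0e; rewrite leqn0 => /eqP->; rewrite subrr frob_norm0 subnn mul0r.
move: e0e; rewrite leq_eqVlt => /predU1P[->|].
  by rewrite subrr frob_norm0 subnn mul0r.
rewrite ltnS => e0e; rewrite subSn// -natr1 mulrDl mul1r.
rewrite [run e.+1]/run /= -/(run e) -/(G e) addrAC.
apply: le_trans (ler_frob_normD _ _) _; apply: lerD.
  by apply: IHe => // e' e'e; [apply: hA|apply: hG]; exact: ltnW.
rewrite frob_normN frob_normZ ger0_norm// -mulrA ler_wpM2l// mulrC.
by apply: ler_frob_normM_bound; rewrite ?frob_normT ?hA ?hG.
Qed.

End local_training.

(** * Displacement of a client between local training and the next round *)

Section displacement.
Context (R : realType) (dout din r N : nat) (Xi : Type).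
Variables (etal etag : R) (E : nat).
Variable g : 'I_N -> 'M[R]_(dout, din) -> Xi -> 'M[R]_(dout, din).
Variable S : nat -> {set 'I_N}.
Variable x : nat -> 'I_N -> nat -> Xi.
Variables (CA CB Gmax : R).
Hypotheses (etal0 : 0 <= etal) (etag0 : 0 <= etag) (E0 : (0 < E)%N).
Hypotheses (CA0 : 0 <= CA) (CB0 : 0 <= CB) (Gmax0 : 0 <= Gmax).

Let Cstar := Num.max CA CB.

Let CA_Cstar : CA * CA <= Cstar ^+ 2.
Proof. by rewrite expr2 ler_pM// le_max lexx. Qed.

Let CB_Cstar : CB * CB <= Cstar ^+ 2.
Proof. by rewrite expr2 ler_pM// le_max lexx orbT. Qed.

Let average_le m n (D : {set 'I_N}) (X : 'I_N -> 'M[R]_(m, n)) c :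
  D != finset.set0 -> (forall i, i \in D -> frob_norm (X i) <= c) ->
  frob_norm ((etag / #|D|%:R) *: \sum_(i in D) X i) <= etag * c.
Proof.
move=> D0 Xc; have D_gt0 : (0 : R) < #|D|%:R by rewrite ltr0n card_gt0.
rewrite frob_normZ ger0_norm ?divr_ge0// -mulrA ler_wpM2l// mulrC.
by rewrite ler_pdivrMr// mulrC; exact: ler_frob_norm_sum.
Qed.

(** Count in units of [etal * CB * Gmax], or [etal * CA * Gmax] for the local factor. Aggregation
    moves the shared factor by at most [etag * E] units from [A0], and [e] local steps by [e] units.
    Compared with step [E], only the shared factor differs: [(etag + 1) * E] units. Compared with
    step [E.-1], it accounts for [etag * E + E.-1] units and the local factor for one more, so the
    total is the same. An unselected client only undergoes the aggregation. *)
Lemma displacement_shareA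
  (q0 : 'M[R]_(shared_rows dout r ShareA, shared_cols din r ShareA))
  (p0 : 'I_N -> 'M[R]_(local_rows dout r ShareA, local_cols din r ShareA)) t i :
  let AB t i e := client_factors etal etag E g S q0 p0 x t i e in
  S t != finset.set0 ->
  (forall j e, j \in S t -> (e <= E)%N ->
     frob_norm (AB t j e).1 <= CA /\ frob_norm (AB t j e).2 <= CB) ->
  (forall j e, j \in S t -> (e < E)%N ->
     frob_norm (g j (update (AB t j e)) (x t j e)) <= Gmax) ->
  frob_norm (AB t i 0%N).2 <= CB ->
  if i \in S t then
    frob_norm (update (AB t.+1 i 0%N) - update (AB t i E)) <=
      (1 + etag) * etal * E%:R * Cstar ^+ 2 * Gmax /\
    frob_norm (update (AB t.+1 i 0%N) - update (AB t i E.-1)) <=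
      (1 + etag) * etal * E%:R * Cstar ^+ 2 * Gmax
  else frob_norm (update (AB t.+1 i 0%N) - update (AB t i 0%N)) <=
      etag * etal * E%:R * Cstar ^+ 2 * Gmax.
Proof.
move=> AB St0 hAB hG hBi.
pose A0 : 'M[R]_(r, din) := (fed_state_at etal etag E g S q0 p0 x t).1.
pose Anew : 'M[R]_(r, din) :=
  A0 + (etag / #|S t|%:R) *: \sum_(j in S t) ((AB t j E).1 - A0).
have drift j e0 e : j \in S t -> (e0 <= e)%N -> (e <= E)%N ->
    frob_norm ((AB t j e).1 - (AB t j e0).1) <= (e - e0)%:R * (etal * CB * Gmax).
  move=> jS e0e eE; apply: local_drift1 => // e' e'e; last first.
    by apply: hG => //; exact: leq_trans eE.
  by have [] := hAB j e' jS (leq_trans (ltnW e'e) eE).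
have Anew_le : frob_norm (Anew - A0) <= etag * (E%:R * (etal * CB * Gmax)).
  rewrite /Anew [A0 + _]addrC addrK; apply: average_le => // j jS.
  by have := drift j 0%N E jS (leq0n _) (leqnn _); rewrite subn0.
have nextE : AB t.+1 i 0%N =
    (Anew, if i \in S t then (AB t i E).2 else (AB t i 0%N).2) by [].
have CBG : CB * CB * (etal * Gmax) <= Cstar ^+ 2 * (etal * Gmax).
  by rewrite ler_wpM2r// mulr_ge0.
have CAG : CA * CA * (etal * Gmax) <= Cstar ^+ 2 * (etal * Gmax).
  by rewrite ler_wpM2r// mulr_ge0.
case: ifPn => iS; last first.
  rewrite nextE (negPf iS).
  have -> : update (Anew, (AB t i 0%N).2) - update (AB t i 0%N) =
      (AB t i 0%N).2 *m (Anew - A0) by rewrite mulmxBr.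
  apply: le_trans (ler_frob_normM_bound hBi Anew_le) _.
  rewrite [leLHS](_ : _ = etag * E%:R * (CB * CB * (etal * Gmax))); last by ring.
  rewrite [leRHS](_ : _ = etag * E%:R * (Cstar ^+ 2 * (etal * Gmax))); last by ring.
  by rewrite ler_wpM2l// mulr_ge0.
have AnewB e : (e <= E)%N -> frob_norm (Anew - (AB t i e).1) <=
    (etag * E%:R + e%:R) * (etal * CB * Gmax).
  move=> eE; rewrite -(subrKA A0) mulrDl -mulrA.
  apply: le_trans (ler_frob_normD _ _) _; apply: lerD => //.
  rewrite -frob_normN opprB.
  by have := drift i 0%N e iS (leq0n _) eE; rewrite subn0.
rewrite nextE iS; have [_ hBE] := hAB i E iS (leqnn _).
split.
  rewrite /update -mulmxBr.
  apply: le_trans (ler_frob_normM_bound hBE (AnewB _ (leqnn _))) _.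
  rewrite [leLHS](_ : _ = (1 + etag) * E%:R * (CB * CB * (etal * Gmax))); last by ring.
  rewrite [leRHS](_ : _ = (1 + etag) * E%:R * (Cstar ^+ 2 * (etal * Gmax))); last by ring.
  by rewrite ler_wpM2l// mulr_ge0// addr_ge0.
have EpE : (E.-1 <= E)%N by exact: leq_pred.
have [hAp _] := hAB i E.-1 iS EpE.
have Bdrift : frob_norm ((AB t i E).2 - (AB t i E.-1).2) <= etal * CA * Gmax.
  have := @local_drift2 _ _ _ _ _ _ etal g i (x t i) (AB t i 0%N) etal0
    CA Gmax E.-1 E EpE CA0.
  rewrite -subn1 subKn// mul1r; apply=> e' e'E; last exact: hG.
  by have [] := hAB i e' iS (ltnW e'E).
have -> : update (Anew, (AB t i E).2) - update (AB t i E.-1) =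
    ((AB t i E).2 - (AB t i E.-1).2) *m (AB t i E.-1).1
    + (AB t i E).2 *m (Anew - (AB t i E.-1).1).
  by rewrite mulmxBl mulmxBr [RHS]addrC subrKA.
apply: le_trans (ler_frob_normD _ _) _.
apply: le_trans (lerD (ler_frob_normM_bound Bdrift hAp)
  (ler_frob_normM_bound hBE (AnewB _ EpE))) _.
rewrite [leLHS](_ : _ = CA * CA * (etal * Gmax)
  + (etag * E%:R + E.-1%:R) * (CB * CB * (etal * Gmax))); last by ring.
have -> : E%:R = 1 + E.-1%:R :> R by rewrite nat1r prednK.
rewrite [leRHS](_ : _ = Cstar ^+ 2 * (etal * Gmax)
  + (etag * (1 + E.-1%:R) + E.-1%:R) * (Cstar ^+ 2 * (etal * Gmax))); last by ring.
by rewrite lerD// ler_wpM2l// addr_ge0// mulr_ge0// addr_ge0.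
Qed.

(** Mirror image of the previous case, with the roles of the two factors and of [CA] and [CB]
    exchanged. *)
Lemma displacement_shareB
  (q0 : 'M[R]_(shared_rows dout r ShareB, shared_cols din r ShareB))
  (p0 : 'I_N -> 'M[R]_(local_rows dout r ShareB, local_cols din r ShareB)) t i :
  let AB t i e := client_factors etal etag E g S q0 p0 x t i e in
  S t != finset.set0 ->
  (forall j e, j \in S t -> (e <= E)%N ->
     frob_norm (AB t j e).1 <= CA /\ frob_norm (AB t j e).2 <= CB) ->
  (forall j e, j \in S t -> (e < E)%N ->
     frob_norm (g j (update (AB t j e)) (x t j e)) <= Gmax) ->
  frob_norm (AB t i 0%N).1 <= CA ->
  if i \in S t then
    frob_norm (update (AB t.+1 i 0%N) - update (AB t i E)) <=
      (1 + etag) * etal * E%:R * Cstar ^+ 2 * Gmax /\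
    frob_norm (update (AB t.+1 i 0%N) - update (AB t i E.-1)) <=
      (1 + etag) * etal * E%:R * Cstar ^+ 2 * Gmax
  else frob_norm (update (AB t.+1 i 0%N) - update (AB t i 0%N)) <=
      etag * etal * E%:R * Cstar ^+ 2 * Gmax.
Proof.
move=> AB St0 hAB hG hAi.
pose B0 : 'M[R]_(dout, r) := (fed_state_at etal etag E g S q0 p0 x t).1.
pose Bnew : 'M[R]_(dout, r) :=
  B0 + (etag / #|S t|%:R) *: \sum_(j in S t) ((AB t j E).2 - B0).
have drift j e0 e : j \in S t -> (e0 <= e)%N -> (e <= E)%N ->
    frob_norm ((AB t j e).2 - (AB t j e0).2) <= (e - e0)%:R * (etal * CA * Gmax).
  move=> jS e0e eE; apply: local_drift2 => // e' e'e; last first.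
    by apply: hG => //; exact: leq_trans eE.
  by have [] := hAB j e' jS (leq_trans (ltnW e'e) eE).
have Bnew_le : frob_norm (Bnew - B0) <= etag * (E%:R * (etal * CA * Gmax)).
  rewrite /Bnew [B0 + _]addrC addrK; apply: average_le => // j jS.
  by have := drift j 0%N E jS (leq0n _) (leqnn _); rewrite subn0.
have nextE : AB t.+1 i 0%N =
    (if i \in S t then (AB t i E).1 else (AB t i 0%N).1, Bnew) by [].
have CBG : CB * CB * (etal * Gmax) <= Cstar ^+ 2 * (etal * Gmax).
  by rewrite ler_wpM2r// mulr_ge0.
have CAG : CA * CA * (etal * Gmax) <= Cstar ^+ 2 * (etal * Gmax).
  by rewrite ler_wpM2r// mulr_ge0.
case: ifPn => iS; last first.
  rewrite nextE (negPf iS).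
  have -> : update ((AB t i 0%N).1, Bnew) - update (AB t i 0%N) =
      (Bnew - B0) *m (AB t i 0%N).1 by rewrite mulmxBl.
  apply: le_trans (ler_frob_normM_bound Bnew_le hAi) _.
  rewrite [leLHS](_ : _ = etag * E%:R * (CA * CA * (etal * Gmax))); last by ring.
  rewrite [leRHS](_ : _ = etag * E%:R * (Cstar ^+ 2 * (etal * Gmax))); last by ring.
  by rewrite ler_wpM2l// mulr_ge0.
have BnewB e : (e <= E)%N -> frob_norm (Bnew - (AB t i e).2) <=
    (etag * E%:R + e%:R) * (etal * CA * Gmax).
  move=> eE; rewrite -(subrKA B0) mulrDl -mulrA.
  apply: le_trans (ler_frob_normD _ _) _; apply: lerD => //.
  rewrite -frob_normN opprB.
  by have := drift i 0%N e iS (leq0n _) eE; rewrite subn0.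
rewrite nextE iS; have [hAE _] := hAB i E iS (leqnn _).
split.
  rewrite /update -mulmxBl.
  apply: le_trans (ler_frob_normM_bound (BnewB _ (leqnn _)) hAE) _.
  rewrite [leLHS](_ : _ = (1 + etag) * E%:R * (CA * CA * (etal * Gmax))); last by ring.
  rewrite [leRHS](_ : _ = (1 + etag) * E%:R * (Cstar ^+ 2 * (etal * Gmax))); last by ring.
  by rewrite ler_wpM2l// mulr_ge0// addr_ge0.
have EpE : (E.-1 <= E)%N by exact: leq_pred.
have [_ hBp] := hAB i E.-1 iS EpE.
have Adrift : frob_norm ((AB t i E).1 - (AB t i E.-1).1) <= etal * CB * Gmax.
  have := @local_drift1 _ _ _ _ _ _ etal g i (x t i) (AB t i 0%N) etal0
    CB Gmax E.-1 E EpE CB0.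
  rewrite -subn1 subKn// mul1r; apply=> e' e'E; last exact: hG.
  by have [] := hAB i e' iS (ltnW e'E).
have -> : update ((AB t i E).1, Bnew) - update (AB t i E.-1) =
    (AB t i E.-1).2 *m ((AB t i E).1 - (AB t i E.-1).1)
    + (Bnew - (AB t i E.-1).2) *m (AB t i E).1.
  by rewrite mulmxBl mulmxBr [RHS]addrC subrKA.
apply: le_trans (ler_frob_normD _ _) _.
apply: le_trans (lerD (ler_frob_normM_bound hBp Adrift)
  (ler_frob_normM_bound (BnewB _ EpE) hAE)) _.
rewrite [leLHS](_ : _ = CB * CB * (etal * Gmax)
  + (etag * E%:R + E.-1%:R) * (CA * CA * (etal * Gmax))); last by ring.
have -> : E%:R = 1 + E.-1%:R :> R by rewrite nat1r prednK.
rewrite [leRHS](_ : _ = Cstar ^+ 2 * (etal * Gmax)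
  + (etag * (1 + E.-1%:R) + E.-1%:R) * (Cstar ^+ 2 * (etal * Gmax))); last by ring.
by rewrite lerD// ler_wpM2l// addr_ge0// mulr_ge0// addr_ge0.
Qed.

Lemma displacement (Q : sharing)
  (q0 : 'M[R]_(shared_rows dout r Q, shared_cols din r Q))
  (p0 : 'I_N -> 'M[R]_(local_rows dout r Q, local_cols din r Q)) t i :
  let AB t i e := client_factors etal etag E g S q0 p0 x t i e in
  S t != finset.set0 ->
  (forall j e, (j \in S t) && (e <= E)%N || (e == 0%N) ->
     frob_norm (AB t j e).1 <= CA /\ frob_norm (AB t j e).2 <= CB) ->
  (forall j e, j \in S t -> (e < E)%N ->
     frob_norm (g j (update (AB t j e)) (x t j e)) <= Gmax) ->
  if i \in S t then
    frob_norm (update (AB t.+1 i 0%N) - update (AB t i E)) <=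
      (1 + etag) * etal * E%:R * Cstar ^+ 2 * Gmax /\
    frob_norm (update (AB t.+1 i 0%N) - update (AB t i E.-1)) <=
      (1 + etag) * etal * E%:R * Cstar ^+ 2 * Gmax
  else frob_norm (update (AB t.+1 i 0%N) - update (AB t i 0%N)) <=
      etag * etal * E%:R * Cstar ^+ 2 * Gmax.
Proof.
case: Q q0 p0 => q0 p0 AB St0 hAB hG; have [hA0 hB0] := hAB i 0%N (orbT _).
  by apply: displacement_shareA => // j e jS eE; apply: hAB; rewrite jS eE.
by apply: displacement_shareB => // j e jS eE; apply: hAB; rewrite jS eE.
Qed.

End displacement.

Section measurable_iterates.
Context (R : realType) (dout din r N : nat).
Context d (T : measurableType d) dX (Xi : measurableType dX).
Variables (Q : sharing) (etal etag : R) (E : nat).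
Variable g : 'I_N -> 'M[R]_(dout, din) -> Xi -> 'M[R]_(dout, din).
Hypothesis mg : forall i, measurable_fun [set: borel_mx R dout din * Xi]
  (fun ux : borel_mx R dout din * Xi => g i ux.1 ux.2 : borel_mx R dout din).
Variable S : nat -> {set 'I_N}.
Variable q0 : 'M[R]_(shared_rows dout r Q, shared_cols din r Q).
Variable p0 : 'I_N -> 'M[R]_(local_rows dout r Q, local_cols din r Q).
Variable x : nat -> 'I_N -> nat -> T -> Xi.
Hypothesis mx : forall t i e, measurable_fun setT (x t i e).

Definition measurable_factors (F : T -> factors R dout din r) :=
  measurable_mx (fun w => (F w).1) /\ measurable_mx (fun w => (F w).2).

Lemma measurable_update (F : T -> factors R dout din r) :
  measurable_factors F -> measurable_mx (fun w => update (F w)).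
Proof. by move=> [mA mB]; exact: measurable_mxM. Qed.

Lemma measurable_gradient i (U : T -> 'M[R]_(dout, din)) (z : T -> Xi) :
  measurable_mx U -> measurable_fun setT z -> measurable_mx (fun w => g i (U w) (z w)).
Proof.
move=> mU mz; apply: borel_measurable_mx.
apply: (measurableT_comp (mg i) (g := fun w => (U w : borel_mx R dout din, z w))).
by apply: measurable_fun_pair => //; exact: measurable_mx_borel.
Qed.

Lemma measurable_local_run i (z : nat -> T -> Xi) (F : T -> factors R dout din r) e :
  (forall e, measurable_fun setT (z e)) -> measurable_factors F ->
  measurable_factors (fun w => local_run etal g i (fun e => z e w) (F w) e).
Proof.
move=> mz mF; elim: e => //= e [mA mB].
have mG := measurable_gradient i (measurable_update (conj mA mB)) (mz e).
by split; apply: measurable_mxD => //; apply: measurable_mxN; apply: measurable_mxZ;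
  apply: measurable_mxM => //; exact: measurable_mxT.
Qed.

Let state t w := fed_state_at etal etag E g S q0 p0 (fun t i e => x t i e w) t.

Let measurable_state t : measurable_mx (fun w => (state t w).1) /\
  forall i, measurable_mx (fun w => (state t w).2 i).
Proof.
have join_meas (X : T -> 'M[R]_(shared_rows dout r Q, shared_cols din r Q))
    (Y : T -> 'M[R]_(local_rows dout r Q, local_cols din r Q)) :
  measurable_mx X -> measurable_mx Y ->
  measurable_factors (fun w => join_factors (X w) (Y w)).
  by clear; case: Q X Y => X Y mX mY; split.
have part_meas (F : T -> factors R dout din r) : measurable_factors F ->
  measurable_mx (fun w => shared_part Q (F w)) /\
  measurable_mx (fun w => local_part Q (F w)).
  by clear; case: Q => -[].
elim: t => [|t [mq mp]]; first by split=> [|i]; exact: measurable_mx_cst.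
have mrun i := part_meas _ (measurable_local_run i E (mx t i) (join_meas _ _ mq (mp i))).
split=> [|i] /=.
  apply: measurable_mxD => //; apply: measurable_mxZ.
  apply: measurable_mx_sum => i; apply: measurable_mxD; last exact: measurable_mxN.
  by have [] := mrun i.
by rewrite /state /=; case: (i \in S t); [have [] := mrun i|exact: mp].
Qed.

Lemma measurable_client_factors t i e : measurable_factors
  (fun w => client_factors etal etag E g S q0 p0 (fun t i e => x t i e w) t i e).
Proof.
have [mq mp] := measurable_state t; apply: measurable_local_run => //.
by move: (mp i) mq; rewrite /state; clear; case: Q q0 p0 => q1 p1 mp mq; split.
Qed.

End measurable_iterates.

(** * Expected descent *)

(** A guard that does not depend on the outcome passes inside the almost sure quantifier; countably
    many guarded bounds can then share one null set. *)
Lemma ae_imply d (T : measurableType d) (R : realType) (P : probability T R)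
  (b : bool) (Q : T -> Prop) :
  (b -> {ae P, forall w, Q w}) -> {ae P, forall w, b -> Q w}.
Proof.
by case: b => [/(_ isT)|_]; [apply: filterS => w Qw _|apply: aeW].
Qed.

Section descent.
Context (R : realType) (dout din r N T E : nat) (hE : (0 < E)%N)
  (d : measure_display) (Omega : measurableType d) (P : probability Omega R)
  (dX : measure_display) (Xi : measurableType dX)
  (xi : nat -> 'I_N -> nat -> {RV P >-> Xi})
  (f : 'I_N -> 'M[R]_(dout, din) -> R)
  (g : 'I_N -> 'M[R]_(dout, din) -> Xi -> 'M[R]_(dout, din))
  (hg : forall i, measurable_fun [set: borel_mx R dout din * Xi]
    (fun ux : borel_mx R dout din * Xi => g i ux.1 ux.2 : borel_mx R dout din))
  (Q : sharing) (etal etag : R) (hetal : 0 < etal) (hetag : 0 < etag)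
  (S : nat -> {set 'I_N}) (hS : forall t, (t < T)%N -> S t != finset.set0)
  (q0 : 'M[R]_(shared_rows dout r Q, shared_cols din r Q))
  (p0 : 'I_N -> 'M[R]_(local_rows dout r Q, local_cols din r Q))
  (L Gmax CA CB cA cB : R)
  (hL : 0 <= L) (hGmax : 0 < Gmax) (hCA : 0 < CA) (hCB : 0 < CB).

Let AB t i e (w : Omega) :=
  client_factors etal etag E g S q0 p0 (fun t i e => xi t i e w) t i e.
Let A t i e w := (AB t i e w).1.
Let B t i e w := (AB t i e w).2.
Let U t i e w := update (AB t i e w).
Let G t i e w := g i (U t i e w) (xi t i e w).
Let Gbar t i e w := grad (f i) (U t i e w).

Hypothesis hsmooth : forall i, smooth L (f i).
Hypothesis hfresh : forall t i e, (t < T)%N -> i \in S t -> (e < E)%N ->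
  independent P (fun w => AB t i e w : borel_mx R r din * borel_mx R dout r)
    (xi t i e).
Hypothesis hunbiased : forall t i e, (t < T)%N -> i \in S t -> (e < E)%N ->
  is_mx_cond_expectation P (fun w => U t i e w : borel_mx R dout din)
    (G t i e) (Gbar t i e).
Hypothesis hbounded : forall t i e, (t < T)%N -> i \in S t -> (e < E)%N ->
  {ae P, forall w, frob_norm (G t i e w) <= Gmax}.
Hypothesis hparam : forall t i e, (t < T)%N ->
  (i \in S t) && (e <= E)%N || (e == 0%N) ->
  {ae P, forall w, frob_norm (A t i e w) <= CA /\ frob_norm (B t i e w) <= CB}.
Hypothesis halign : forall t i e, (t < T)%N -> i \in S t -> (e < E)%N ->
  {ae P, forall w,
    cA * frob_norm (Gbar t i e w) ^+ 2
      <= frob_inner ((A t i e w)^T *m A t i e w)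
                    ((Gbar t i e w)^T *m Gbar t i e w) /\
    cB * frob_norm (Gbar t i e w) ^+ 2
      <= frob_inner (B t i e w *m (B t i e w)^T)
                    (Gbar t i e w *m (Gbar t i e w)^T)}.

Let mAB t i e : measurable_factors (AB t i e).
Proof. by apply: measurable_client_factors => // *; exact: measurable_funPT. Qed.

Let bA t i e : (t < T)%N -> (i \in S t) && (e <= E)%N || (e == 0%N) ->
  ae_bounded_mx P (A t i e).
Proof.
move=> tT ie; split; first by have [] := mAB t i e.
by exists CA; apply: filterS (hparam tT ie) => w [].
Qed.

Let bB t i e : (t < T)%N -> (i \in S t) && (e <= E)%N || (e == 0%N) ->
  ae_bounded_mx P (B t i e).
Proof.
move=> tT ie; split; first by have [] := mAB t i e.
by exists CB; apply: filterS (hparam tT ie) => w [].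
Qed.

Let bU t i e : (t < T)%N -> (i \in S t) && (e <= E)%N || (e == 0%N) ->
  ae_bounded_mx P (U t i e).
Proof. by move=> tT ie; apply: ae_bounded_mxM; [exact: bB|exact: bA]. Qed.

Let bG t i e : (t < T)%N -> i \in S t -> (e < E)%N -> ae_bounded_mx P (G t i e).
Proof.
move=> tT iS eE; split; last by exists Gmax; exact: hbounded.
by apply: (measurable_gradient hg) => //; exact: measurable_update.
Qed.

Let bGbar t i e : (t < T)%N -> (i \in S t) && (e <= E)%N || (e == 0%N) ->
  ae_bounded_mx P (Gbar t i e).
Proof. by move=> tT ie; apply: (ae_bounded_grad (hsmooth i)); exact: bU. Qed.

Let ltE t i e : i \in S t -> (e < E)%N -> (i \in S t) && (e <= E)%N || (e == 0%N).
Proof. by move=> -> /ltnW ->. Qed.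

Let ltSE t i e : i \in S t -> (e < E)%N ->
  (i \in S t) && (e.+1 <= E)%N || (e.+1 == 0%N).
Proof. by move=> -> ->. Qed.

Let mfactor1 : measurable_mx
  (fun ab : borel_mx R r din * borel_mx R dout r => ab.1 : 'M[R]_(r, din)).
Proof. by apply: borel_measurable_mx; exact: measurable_fst. Qed.

Let mfactor2 : measurable_mx
  (fun ab : borel_mx R r din * borel_mx R dout r => ab.2 : 'M[R]_(dout, r)).
Proof. by apply: borel_measurable_mx; exact: measurable_snd. Qed.

Let mproduct : measurable_mx
  (fun ab : borel_mx R r din * borel_mx R dout r => update ab).
Proof. exact: measurable_mxM. Qed.

Let unbiased_inner t i e
    (W : borel_mx R r din * borel_mx R dout r -> 'M[R]_(dout, din)) :
  (t < T)%N -> i \in S t -> (e < E)%N -> measurable_mx W ->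
  ae_bounded_mx P (fun w => W (AB t i e w)) ->
  \int[P]_w frob_inner (W (AB t i e w)) (G t i e w) =
  \int[P]_w frob_inner (W (AB t i e w)) (Gbar t i e w).
Proof.
move=> tT iS eE mW bW.
have mX : measurable_fun setT
    (fun w => AB t i e w : borel_mx R r din * borel_mx R dout r).
  have [mA mB] := mAB t i e.
  have := measurable_fun_pair (measurable_mx_borel mA) (measurable_mx_borel mB).
  by under eq_fun do rewrite -surjective_pairing.
pose X : {RV P >-> (borel_mx R r din * borel_mx R dout r)%type} :=
  mfun_Sub (mem_set mX).
apply: (@frob_inner_cond_expectation _ _ _ _ _ _ _ P X (xi t i e) _ _
  (fun ab => update ab) (g i) (grad (f i)) W) => //.
- exact: hfresh.
- by apply: (measurable_grad (hsmooth i)); apply: borel_measurable_mx; exact: measurable_id.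
- exact: hunbiased.
- exact: bG.
- by apply: bGbar => //; exact: ltE.
Qed.

(** The mean gradient is itself an admissible weight, so its second moment equals the mean of its
    inner product with [G]. Young's inequality with weight 1 bounds this by half the second moment
    plus [Gmax ^+ 2 / 2], and the half is absorbed, the moment being finite. *)
Let gradient_second_moment t i e : (t < T)%N -> i \in S t -> (e < E)%N ->
  \int[P]_w (frob_norm (Gbar t i e w) ^+ 2) <= Gmax ^+ 2.
Proof.
move=> tT iS eE; have bGb := bGbar tT (ltE iS eE); have bGs := bG tT iS eE.
have bGb2 := ae_bounded_frob_norm_sqr bGb.
have mW : measurable_mx (fun ab : borel_mx R r din * borel_mx R dout r =>
    grad (f i) (update ab)) by exact: (measurable_grad (hsmooth i)).
have h := unbiased_inner tT iS eE mW bGb.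
have : \int[P]_w (frob_norm (Gbar t i e w) ^+ 2) <=
    \int[P]_w (2^-1 * frob_norm (Gbar t i e w) ^+ 2 + 2^-1 * Gmax ^+ 2).
  rewrite [leLHS](_ : _ = \int[P]_w frob_inner (Gbar t i e w) (G t i e w)); last first.
    by rewrite h; apply: eq_Rintegral => w _; rewrite frob_normE.
  apply: ae_le_Rintegral.
  - exact: ae_bounded_frob_inner.
  - by apply: ae_boundedD; [exact: ae_boundedZ|exact: ae_bounded_cst].
  apply: filterS (hbounded tT iS eE) => w Gw.
  apply: le_trans (frob_inner_young _ _ ltr01) _.
  by rewrite !mulr1 mul1r lerD2l ler_wpM2l ?invr_ge0// ler_sqr ?nnegrE ?frob_norm_ge0// ltW.
rewrite Rintegral_ae_boundedD; [|exact: ae_boundedZ|exact: ae_bounded_cst].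
rewrite Rintegral_ae_boundedZ// Rintegral_probability_cst; lra.
Qed.

Let descent_inner t i e : (t < T)%N -> i \in S t -> (e < E)%N ->
  \int[P]_w frob_inner (Gbar t i e w) (U t i e.+1 w - U t i e w) <=
  - etal * (cA + cB) * \int[P]_w (frob_norm (Gbar t i e w) ^+ 2)
  + etal ^+ 2 * CA * CB * Gmax ^+ 3.
Proof.
move=> tT iS eE; have ie := ltE iS eE.
have bGb := bGbar tT ie; have bGs := bG tT iS eE.
have bAe := bA tT ie; have bBe := bB tT ie.
have bGb2 := ae_bounded_frob_norm_sqr bGb.
(* By adjunction, the first-order part of the inner product is [- etal] times that of [W] with [G].
   [W] is a function of the pair of factors, so [G] may be replaced by [Gbar] under the integral. *)
pose W (ab : borel_mx R r din * borel_mx R dout r) : 'M[R]_(dout, din) :=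
  let A := ab.1 : 'M[R]_(r, din) in let B := ab.2 : 'M[R]_(dout, r) in
  let Gb := grad (f i) (update ab) in B *m B^T *m Gb + Gb *m A^T *m A.
have mgr : measurable_mx (fun ab : borel_mx R r din * borel_mx R dout r =>
    grad (f i) (update ab)) by exact: (measurable_grad (hsmooth i)).
have mW : measurable_mx W.
  by apply: measurable_mxD; repeat (apply: measurable_mxM || apply: measurable_mxT).
have bW : ae_bounded_mx P (fun w => W (AB t i e w)).
  by apply: ae_bounded_mxD; repeat (apply: ae_bounded_mxM || apply: ae_bounded_mxT).
have WG := unbiased_inner tT iS eE mW bW.
pose V w := G t i e w *m (A t i e w)^T *m (B t i e w)^T *m G t i e w.
have bV : ae_bounded_mx P V.
  by repeat (apply: ae_bounded_mxM || apply: ae_bounded_mxT).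
have innerE w : frob_inner (Gbar t i e w) (U t i e.+1 w - U t i e w) =
    - etal * frob_inner (W (AB t i e w)) (G t i e w)
    + etal ^+ 2 * frob_inner (Gbar t i e w) (V w).
  rewrite [U t i e.+1 w - _]update_local_step -/(V w).
  rewrite !(frob_innerDl, frob_innerDr, frob_innerNr, frob_innerZr).
  rewrite frob_inner_mulmxr trmx_mul trmxK.
  rewrite -[G t i e w *m _ *m _]mulmxA frob_inner_mulmxl trmx_mul trmxK mulmxA.
  rewrite -/(Gbar t i e w) -/(A t i e w) -/(B t i e w) -/(G t i e w); ring.
under eq_Rintegral do rewrite innerE.
have bWG := ae_bounded_frob_inner bW bGs; have bGV := ae_bounded_frob_inner bGb bV.
rewrite Rintegral_ae_boundedD; [|exact: ae_boundedZ..].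
rewrite !Rintegral_ae_boundedZ// WG -mulrA; apply: lerD.
  rewrite ler_wnM2l ?oppr_le0 ?(ltW hetal)// -Rintegral_ae_boundedZ//.
  apply: ae_le_Rintegral; [exact: ae_boundedZ|exact: ae_bounded_frob_inner|].
  apply: filterS (halign tT iS eE) => w [alA alB].
  rewrite frob_innerDl mulrDl addrC lerD//.
    by rewrite (le_trans alB)// frob_inner_mulmxl trmxK.
  by rewrite (le_trans alA)// frob_inner_mulmxr trmxK mulmxA.
have CAB0 : 0 <= CA * CB * Gmax ^+ 2 by rewrite !mulr_ge0// ltW.
(* The norm of [Gbar] is at most [Gmax / 2] plus its square over [2 * Gmax]; the second moment bound
   then makes its mean contribute a single factor [Gmax]. *)
have le2 : \int[P]_w frob_inner (Gbar t i e w) (V w) <= CA * CB * Gmax ^+ 3.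
  apply: (@le_trans _ _ (\int[P]_w (CA * CB * Gmax ^+ 2 *
      (Gmax / 2 + (2 * Gmax)^-1 * frob_norm (Gbar t i e w) ^+ 2)))).
    apply: ae_le_Rintegral => //.
      by apply: ae_boundedZ; apply: ae_boundedD; [exact: ae_bounded_cst|exact: ae_boundedZ].
    apply: filterS2 (hbounded tT iS eE) (hparam tT ie) => w Gw [Aw Bw].
    apply: le_trans (frob_inner_le _ _) _; rewrite mulrC.
    apply: ler_pM; rewrite ?frob_norm_ge0//.
      have -> : CA * CB * Gmax ^+ 2 = Gmax * CA * CB * Gmax by ring.
      by rewrite !ler_frob_normM_bound ?frob_normT.
    have G2 : 0 < 2 * Gmax by rewrite mulr_gt0.
    rewrite -(ler_pM2l G2) mulrDr mulVKf ?gt_eqF//.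
    by have := sqr_ge0 (frob_norm (Gbar t i e w) - Gmax); lra.
  rewrite Rintegral_ae_boundedZ; last first.
    by apply: ae_boundedD; [exact: ae_bounded_cst|exact: ae_boundedZ].
  rewrite Rintegral_ae_boundedD; [|exact: ae_bounded_cst|exact: ae_boundedZ].
  rewrite Rintegral_probability_cst Rintegral_ae_boundedZ//.
  rewrite [leRHS](_ : _ = CA * CB * Gmax ^+ 2 * Gmax); last by ring.
  rewrite ler_wpM2l//.
  have := gradient_second_moment tT iS eE.
  have G0 : 0 < (2 * Gmax)^-1 by rewrite invr_gt0 mulr_gt0.
  rewrite -(ler_pM2l G0) => h; apply: le_trans (lerD (lexx _) h) _.
  by rewrite le_eqVlt; apply/orP; left; apply/eqP; field; rewrite gt_eqF.
rewrite [leRHS](_ : _ = etal ^+ 2 * (CA * CB * Gmax ^+ 3)); last by ring.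
by rewrite ler_wpM2l// sqr_ge0.
Qed.

(** The first term comes from the second-order part of the step paired with the gradient; the other
    two are [L / 2] times the bound of [step_sqr_le]. *)
Let local_step_cost := etal ^+ 2 * CA * CB * Gmax ^+ 3
  + 3 * L / 2 * etal ^+ 2 * (CA ^+ 4 + CB ^+ 4) * Gmax ^+ 2
  + 3 * L / 2 * etal ^+ 4 * CA ^+ 2 * CB ^+ 2 * Gmax ^+ 4.

Let bfU t i e : (t < T)%N -> (i \in S t) && (e <= E)%N || (e == 0%N) ->
  ae_bounded P (fun w => f i (U t i e w)).
Proof. by move=> tT ie; apply: (ae_bounded_smooth (hsmooth i)); exact: bU. Qed.

Let step_sqr_le t i e : (t < T)%N -> i \in S t -> (e < E)%N ->
  {ae P, forall w, frob_norm (U t i e.+1 w - U t i e w) ^+ 2 <=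
    3 * etal ^+ 2 * (CA ^+ 4 + CB ^+ 4) * Gmax ^+ 2
    + 3 * etal ^+ 4 * CA ^+ 2 * CB ^+ 2 * Gmax ^+ 4}.
Proof.
move=> tT iS eE.
apply: filterS2 (hbounded tT iS eE) (hparam tT (ltE iS eE)) => w Gw [Aw Bw].
rewrite update_local_step -/(A t i e w) -/(B t i e w) -/(G t i e w).
apply: le_trans (frob_normD3_sqr _ _ _) _.
rewrite [leRHS](_ : _ = 3 * ((etal * (CB * CB * Gmax)) ^+ 2
  + (etal * (Gmax * CA * CA)) ^+ 2
  + (etal ^+ 2 * (Gmax * CA * CB * Gmax)) ^+ 2)); last by ring.
rewrite ler_wpM2l// !lerD//; apply: ler_frob_norm_sqr.
- rewrite frob_normZ normrN gtr0_norm// ler_wpM2l ?(ltW hetal)//.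
  by rewrite !ler_frob_normM_bound ?frob_normT.
- rewrite frob_normN frob_normZ gtr0_norm// ler_wpM2l ?(ltW hetal)//.
  by rewrite !ler_frob_normM_bound ?frob_normT.
- rewrite frob_normZ ger0_norm ?sqr_ge0// ler_wpM2l ?sqr_ge0//.
  by rewrite !ler_frob_normM_bound ?frob_normT.
Qed.

Let local_descent t i e : (t < T)%N -> i \in S t -> (e < E)%N ->
  \int[P]_w f i (U t i e.+1 w) + etal * (cA + cB) *
    \int[P]_w (frob_norm (Gbar t i e w) ^+ 2) <=
  \int[P]_w f i (U t i e w) + local_step_cost.
Proof.
move=> tT iS eE; have ie := ltE iS eE; have ie1 := ltSE iS eE.
have bGb := bGbar tT ie.
have bD : ae_bounded_mx P (fun w => U t i e.+1 w - U t i e w).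
  by apply: ae_bounded_mxD; [exact: bU|apply: ae_bounded_mxN; exact: bU].
pose K := 3 * etal ^+ 2 * (CA ^+ 4 + CB ^+ 4) * Gmax ^+ 2
  + 3 * etal ^+ 4 * CA ^+ 2 * CB ^+ 2 * Gmax ^+ 4.
have := descent_inner tT iS eE.
have bI := ae_bounded_frob_inner bGb bD.
have : \int[P]_w f i (U t i e.+1 w) <= \int[P]_w (f i (U t i e w)
    + (frob_inner (Gbar t i e w) (U t i e.+1 w - U t i e w) + L / 2 * K)).
  apply: ae_le_Rintegral; first exact: bfU.
    by do 2 (apply: ae_boundedD => //; try exact: bfU); exact: ae_bounded_cst.
  apply: filterS (step_sqr_le tT iS eE) => w Dw.
  apply: le_trans ((hsmooth i).2 (U t i e w) (U t i e.+1 w)) _.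
  by rewrite -addrA !lerD2l ler_wpM2l// divr_ge0.
rewrite Rintegral_ae_boundedD; [|exact: bfU|by apply: ae_boundedD => //; exact: ae_bounded_cst].
rewrite Rintegral_ae_boundedD//; last exact: ae_bounded_cst.
by rewrite Rintegral_probability_cst /K /local_step_cost; lra.
Qed.

(** Only the gain of step 0 is retained; those of the later steps are nonnegative and dropped. *)
Let local_descent_sum t i e : (t < T)%N -> i \in S t -> (e < E)%N ->
  0 <= cA + cB ->
  \int[P]_w f i (U t i e.+1 w) + etal * (cA + cB) *
    \int[P]_w (frob_norm (Gbar t i 0%N w) ^+ 2) <=
  \int[P]_w f i (U t i 0%N w) + e.+1%:R * local_step_cost.
Proof.
move=> tT iS + c0; elim: e => [|e IHe] eE.
  by rewrite mul1r; exact: local_descent.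
have arith (a b c s p k n : R) :
  b + s <= c + n * k -> a + p <= b + k -> 0 <= p -> a + s <= c + (n + 1) * k.
  by lra.
rewrite -[e.+2%:R]natr1; apply: arith (IHe (ltnW eE)) (local_descent tT iS eE) _.
by rewrite !mulr_ge0 ?(ltW hetal)//; apply: Rintegral_ge0 => w _; exact: sqr_ge0.
Qed.

Let ae_round t : (t < T)%N -> {ae P, forall w, forall i,
  if i \in S t then
    frob_norm (U t.+1 i 0%N w - U t i E w) <=
      (1 + etag) * etal * E%:R * Num.max CA CB ^+ 2 * Gmax /\
    frob_norm (U t.+1 i 0%N w - U t i E.-1 w) <=
      (1 + etag) * etal * E%:R * Num.max CA CB ^+ 2 * Gmax
  else frob_norm (U t.+1 i 0%N w - U t i 0%N w) <=
      etag * etal * E%:R * Num.max CA CB ^+ 2 * Gmax}.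
Proof.
move=> tT.
have hAB : {ae P, forall w, forall j e, (j \in S t) && (e <= E)%N || (e == 0%N) ->
    frob_norm (A t j e w) <= CA /\ frob_norm (B t j e w) <= CB}.
  apply: filter_forall => j; apply: ae_foralln => e.
  by apply: ae_imply => ie; exact: hparam.
have hG : {ae P, forall w, forall j e, (j \in S t) && (e < E)%N ->
    frob_norm (G t j e w) <= Gmax}.
  apply: filter_forall => j; apply: ae_foralln => e.
  by apply: ae_imply => /andP[jS eE]; exact: hbounded.
apply: filterS2 hAB hG => w hABw hGw i.
apply: displacement => //; try exact: ltW; first exact: hS.
by move=> j e jS eE; apply: hGw; rewrite jS eE.
Qed.

(** Needed for [t.+1 = T], where no parameter bound is assumed: boundedness is carried over from
    round [t] by the displacement. *)
Let bUnext t i : (t < T)%N -> ae_bounded_mx P (U t.+1 i 0%N).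
Proof.
move=> tT; split; first exact/measurable_update/mAB.
have [M UM] : exists M, {ae P, forall w, frob_norm (U t.+1 i 0%N w) <= M}; last by exists M.
(* The reference iterate is the one at step [E] for a selected client and at step 0 otherwise. *)
have EP : (i \in S t) && ((if i \in S t then E else 0%N) <= E)%N
    || ((if i \in S t then E else 0%N) == 0%N) by case: (i \in S t); rewrite ?leqnn ?eqxx.
have [_ [M UM]] := bU tT EP.
exists ((1 + etag) * etal * E%:R * Num.max CA CB ^+ 2 * Gmax
  + etag * etal * E%:R * Num.max CA CB ^+ 2 * Gmax + M).
have C0 : 0 <= etal * E%:R * Num.max CA CB ^+ 2 * Gmax.
  by rewrite mulr_ge0 ?(ltW hGmax)// mulr_ge0 ?sqr_ge0// mulr_ge0// ltW.
have k0 : 0 <= etag * (etal * E%:R * Num.max CA CB ^+ 2 * Gmax).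
  by rewrite mulr_ge0// ltW.
apply: filterS2 (ae_round tT) UM => w /(_ i).
case: (i \in S t) => [[h _]|h] Uw.
  rewrite -[U t.+1 i 0%N w](subrK (U t i E w)).
  by apply: le_trans (ler_frob_normD _ _) _; rewrite lerD//; move: h k0; lra.
rewrite -[U t.+1 i 0%N w](subrK (U t i 0%N w)).
by apply: le_trans (ler_frob_normD _ _) _; rewrite lerD//; move: h k0 C0; lra.
Qed.

Lemma ae_bounded_start t i : (0 < T)%N -> (t <= T)%N ->
  ae_bounded P (fun w => f i (U t i 0%N w)).
Proof.
move=> T0; case: t => [|t] tT; first by apply: bfU; rewrite ?eqxx ?orbT.
by apply: (ae_bounded_smooth (hsmooth i)); exact: bUnext.
Qed.

Lemma ae_bounded_start_grad t i : (t < T)%N ->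
  ae_bounded P (fun w => frob_norm (Gbar t i 0%N w) ^+ 2).
Proof.
by move=> tT; apply: ae_bounded_frob_norm_sqr; apply: bGbar; rewrite ?eqxx ?orbT.
Qed.

(* The gradient at the last local iterate U t i E is not controlled by the
   assumptions, so the aggregation displacement is charged to the gradient at
   U t i E.-1, from which U t.+1 i 0 is still within the same distance. *)
Lemma selected_descent t i : (t < T)%N -> i \in S t -> 0 <= cA + cB ->
  \int[P]_w f i (U t.+1 i 0%N w) + etal * (cA + cB) *
    \int[P]_w (frob_norm (Gbar t i 0%N w) ^+ 2) <=
  \int[P]_w f i (U t i 0%N w) + R_sel E L etal etag CA CB Gmax.
Proof.
move=> tT iS c0.
(* [p] and [q] are the second moments of the gradient at steps [E.-1] and 0, and [k] is the cost of
   the first [E.-1] steps. The slack [l] is the quadratic cost of the last step as counted in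
   [R_sel]: here that step is covered by the quadratic term of the whole displacement. *)
have arith (a b1 b2 b3 p q v k l z u c h : R) :
  b1 <= b2 + (a + (h * p + z)) -> a <= - etal * c * p + v ->
  h * p <= u -> b2 + etal * c * q <= b3 + k + etal * c * p -> 0 <= l ->
  b1 + etal * c * q <= b3 + (k + v + l + u + z).
  by lra.
have eE : (E.-1 < E)%N by rewrite prednK.
have ie := ltE iS eE.
pose Dm := (1 + etag) * etal * E%:R * Num.max CA CB ^+ 2 * Gmax.
have bGb := bGbar tT ie; have bUp := bU tT ie.
have bGb2 := ae_bounded_frob_norm_sqr bGb.
have bUE : ae_bounded_mx P (U t i E) by apply: bU; rewrite ?iS ?leqnn.
have bfp := bfU tT ie.
have bD : ae_bounded_mx P (fun w => U t i E w - U t i E.-1 w).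
  by apply: ae_bounded_mxD => //; exact: ae_bounded_mxN.
have bI := ae_bounded_frob_inner bGb bD.
have bfn : ae_bounded P (fun w => f i (U t.+1 i 0%N w)).
  by apply: (ae_bounded_smooth (hsmooth i)); exact: bUnext.
have bGb2' := ae_boundedZ (etal / 2) bGb2.
have bK := ae_bounded_cst P (((2 * etal)^-1 + L / 2) * Dm ^+ 2).
(* Smoothness is applied once, from step [E.-1] to the next round. The linear term splits into the
   last local step, kept for [descent_inner], and the aggregation, handled by Young's inequality. *)
have main : \int[P]_w f i (U t.+1 i 0%N w) <= \int[P]_w (f i (U t i E.-1 w)
    + (frob_inner (Gbar t i E.-1 w) (U t i E w - U t i E.-1 w)
    + (etal / 2 * frob_norm (Gbar t i E.-1 w) ^+ 2
    + ((2 * etal)^-1 + L / 2) * Dm ^+ 2))).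
  apply: ae_le_Rintegral => //; first by do 3 apply: ae_boundedD => //.
  apply: filterS (ae_round tT) => w /(_ i); rewrite iS -/Dm => -[D1 D2].
  apply: le_trans ((hsmooth i).2 (U t i E.-1 w) (U t.+1 i 0%N w)) _.
  rewrite -addrA lerD2l -/(Gbar t i E.-1 w).
  rewrite [X in frob_inner _ X](_ : _ = (U t i E w - U t i E.-1 w)
    + (U t.+1 i 0%N w - U t i E w)); last by rewrite [RHS]addrC subrKA.
  rewrite frob_innerDr -addrA lerD2l.
  rewrite mulrDl addrA; apply: lerD.
    apply: le_trans (frob_inner_young _ _ hetal) _; rewrite lerD2l ler_wpM2l ?ler_frob_norm_sqr//.
    by rewrite invr_ge0 mulr_ge0 ?(ltW hetal).
  by rewrite ler_wpM2l ?ler_frob_norm_sqr// divr_ge0.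
have := descent_inner tT iS eE; rewrite (prednK hE) => inner.
have G2 := gradient_second_moment tT iS eE.
rewrite Rintegral_ae_boundedD// in main; last by do 2 apply: ae_boundedD => //.
rewrite Rintegral_ae_boundedD// in main; last by apply: ae_boundedD.
rewrite Rintegral_ae_boundedD// Rintegral_ae_boundedZ// in main.
rewrite Rintegral_probability_cst in main.
have G2' : etal / 2 * \int[P]_w (frob_norm (Gbar t i E.-1 w) ^+ 2) <=
    etal / 2 * Gmax ^+ 2 by rewrite ler_wpM2l// divr_ge0// ltW.
(* The extra term on the right is repaid by the gain of the last step. If [E = 1] there is no
   earlier step and both gradient terms coincide; otherwise it is a nonnegative surplus. *)
have prefix : \int[P]_w f i (U t i E.-1 w)
    + etal * (cA + cB) * \int[P]_w (frob_norm (Gbar t i 0%N w) ^+ 2) <=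
    \int[P]_w f i (U t i 0%N w) + E.-1%:R * local_step_cost
    + etal * (cA + cB) * \int[P]_w (frob_norm (Gbar t i E.-1 w) ^+ 2).
  case EE : E.-1 eE => [|e] eE; first by rewrite mul0r addr0.
  apply: le_trans (local_descent_sum tT iS (ltnW eE) c0) _; rewrite lerDl.
  by rewrite !mulr_ge0 ?(ltW hetal)//; apply: Rintegral_ge0 => w _; exact: sqr_ge0.
have L1 : 0 <= 3 * L / 2 * etal ^+ 2 * (CA ^+ 4 + CB ^+ 4) * Gmax ^+ 2
    + 3 * L / 2 * etal ^+ 4 * CA ^+ 2 * CB ^+ 2 * Gmax ^+ 4.
  by rewrite addr_ge0// !mulr_ge0 ?addr_ge0 ?exprn_ge0 ?(ltW hetal) ?(ltW hCA)
    ?(ltW hCB) ?(ltW hGmax).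
suff -> : R_sel E L etal etag CA CB Gmax = E.-1%:R * local_step_cost
    + etal ^+ 2 * CA * CB * Gmax ^+ 3
    + (3 * L / 2 * etal ^+ 2 * (CA ^+ 4 + CB ^+ 4) * Gmax ^+ 2
    + 3 * L / 2 * etal ^+ 4 * CA ^+ 2 * CB ^+ 2 * Gmax ^+ 4)
    + etal / 2 * Gmax ^+ 2 + ((2 * etal)^-1 + L / 2) * Dm ^+ 2.
  exact: arith main inner G2' prefix L1.
have -> : E.-1%:R = E%:R - 1 :> R by rewrite -[in RHS](prednK hE) -natr1 addrK.
by rewrite /R_sel /local_step_cost /Dm /=; ring.
Qed.

Lemma unselected_descent t i rho : (t < T)%N -> i \notin S t -> 0 < rho ->
  \int[P]_w f i (U t.+1 i 0%N w) <= \int[P]_w f i (U t i 0%N w)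
    + rho * etal / 2 * \int[P]_w (frob_norm (Gbar t i 0%N w) ^+ 2)
    + R_uns E L etal etag CA CB Gmax rho.
Proof.
move=> tT iS rho0.
have i0 : (i \in S t) && (0 <= E)%N || (0%N == 0%N) by rewrite orbT.
pose Dm := etag * etal * E%:R * Num.max CA CB ^+ 2 * Gmax.
have bGb2 := ae_boundedZ (rho * etal / 2) (ae_bounded_frob_norm_sqr (bGbar tT i0)).
have bf0 := bfU tT i0.
have re0 : 0 < rho * etal by rewrite mulr_gt0.
have RE : R_uns E L etal etag CA CB Gmax rho =
    ((2 * (rho * etal))^-1 + L / 2) * Dm ^+ 2.
  by rewrite /R_uns /Dm /= mulrA; ring.
rewrite RE -Rintegral_ae_boundedZ; last exact: ae_bounded_start_grad.
have bK := ae_bounded_cst P (((2 * (rho * etal))^-1 + L / 2) * Dm ^+ 2).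
rewrite -Rintegral_ae_boundedD// -[X in _ + X](Rintegral_probability_cst P).
rewrite -Rintegral_ae_boundedD//; last exact: ae_boundedD.
apply: ae_le_Rintegral; last first.
- apply: filterS (ae_round tT) => w /(_ i); rewrite (negPf iS) -/Dm => D1.
  apply: le_trans ((hsmooth i).2 (U t i 0%N w) (U t.+1 i 0%N w)) _.
  rewrite -!addrA lerD2l mulrDl -/(Gbar t i 0%N w).
  have D2 := ler_frob_norm_sqr D1.
  rewrite addrA; apply: lerD; last by rewrite ler_wpM2l// divr_ge0.
  apply: le_trans (frob_inner_young _ _ re0) _; rewrite lerD2l ler_wpM2l//.
  by rewrite invr_ge0 mulr_ge0// ltW.
- by apply: ae_boundedD => //; exact: ae_boundedD.
- by apply: (ae_bounded_smooth (hsmooth i)); exact: bUnext.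
Qed.

End descent.

(** * Coverage, summation over the clients and telescoping over the rounds *)

Theorem theorem2
  (R : realType) (dout din r N T E : nat)
  (hN : (0 < N)%N) (hT : (0 < T)%N) (hE : (0 < E)%N)
  (* probability space and mini-batches *)
  (d : measure_display) (Omega : measurableType d) (P : probability Omega R)
  (dX : measure_display) (Xi : measurableType dX)
  (xi : nat -> 'I_N -> nat -> {RV P >-> Xi})
  (* local objectives and their mini-batch gradients *)
  (f : 'I_N -> 'M[R]_(dout, din) -> R)
  (g : 'I_N -> 'M[R]_(dout, din) -> Xi -> 'M[R]_(dout, din))
  (hg : forall i, measurable_fun [set: borel_mx R dout din * Xi]
    (fun ux : borel_mx R dout din * Xi => g i ux.1 ux.2 : borel_mx R dout din))
  (* sharing strategy, learning rates, participation, initialization *)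
  (Q : sharing) (etal etag : R) (hetal : 0 < etal) (hetag : 0 < etag)
  (S : nat -> {set 'I_N}) (hS : forall t, (t < T)%N -> S t != finset.set0)
  (q0 : 'M[R]_(shared_rows dout r Q, shared_cols din r Q))
  (p0 : 'I_N -> 'M[R]_(local_rows dout r Q, local_cols din r Q))
  (* constants *)
  (L Gmax CA CB cA cB lambda kappa rho Fstar : R)
  (hL : 0 <= L) (hGmax : 0 < Gmax)
  (hCA : 0 < CA) (hCB : 0 < CB) (hcA : 0 < cA) (hcB : 0 < cB)
  (hlambda : 0 < lambda) (hkappa : 0 <= kappa <= E%:R^-1) (hrho : 0 < rho)
  (hc : 0 < rate_const E cA cB kappa lambda rho) :
  let AB t i e (w : Omega) :=
    client_factors etal etag E g S q0 p0 (fun t i e => xi t i e w) t i e in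
  let A t i e w := (AB t i e w).1 in
  let B t i e w := (AB t i e w).2 in
  let U t i e w := update (AB t i e w) in
  let G t i e w := g i (U t i e w) (xi t i e w) in
  let Gbar t i e w := grad (f i) (U t i e w) in
  let F t w := N%:R^-1 * \sum_(i < N) f i (U t i 0%N w) in
  let F0 := N%:R^-1 * \sum_(i < N) f i (update (join_factors q0 (p0 i))) in
  let Gsel t w := N%:R^-1 * \sum_(i in S t) frob_norm (Gbar t i 0%N w) ^+ 2 in
  let Gall t w := N%:R^-1 * \sum_(i < N) frob_norm (Gbar t i 0%N w) ^+ 2 in
  let c := rate_const E cA cB kappa lambda rho in
  (* smoothness *)
  forall (hsmooth : forall i, smooth L (f i))
  (* each mini-batch is a fresh sample *)
  (hfresh : forall t i e, (t < T)%N -> i \in S t -> (e < E)%N ->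
    independent P
      (fun w => AB t i e w : borel_mx R r din * borel_mx R dout r)
      (xi t i e))
  (* unbiased and bounded stochastic gradients *)
  (hunbiased : forall t i e, (t < T)%N -> i \in S t -> (e < E)%N ->
    is_mx_cond_expectation P (fun w => U t i e w : borel_mx R dout din)
      (G t i e) (Gbar t i e))
  (hbounded : forall t i e, (t < T)%N -> i \in S t -> (e < E)%N ->
    {ae P, forall w, frob_norm (G t i e w) <= Gmax})
  (* parameter bounds and alignment *)
  (hparam : forall t i e, (t < T)%N -> (i \in S t) && (e <= E)%N || (e == 0%N) ->
    {ae P, forall w, frob_norm (A t i e w) <= CA /\ frob_norm (B t i e w) <= CB})
  (halign : forall t i e, (t < T)%N -> i \in S t -> (e < E)%N ->
    {ae P, forall w,
      cA * frob_norm (Gbar t i e w) ^+ 2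
        <= frob_inner ((A t i e w)^T *m A t i e w)
                      ((Gbar t i e w)^T *m Gbar t i e w) /\
      cB * frob_norm (Gbar t i e w) ^+ 2
        <= frob_inner (B t i e w *m (B t i e w)^T)
                      (Gbar t i e w *m (Gbar t i e w)^T)})
  (* gradient-mass coverage *)
  (hcoverage : {ae P, forall w, forall t, (t < T)%N ->
    0 < Gall t w -> lambda <= Gsel t w / Gall t w})
  (* lower bound of the aggregate objective *)
  (hFstar : {ae P, forall w, forall t, (t <= T)%N -> Fstar <= F t w}),
  (((N%:R * T%:R)^-1)%:E *
     \sum_(t < T) \sum_(i < N)
       'E_P[fun w => (frob_norm (grad (f i) (U t i 0%N w)) ^+ 2)%R]
   <= ((F0 - Fstar) / (etal * c * T%:R)
       + (etal * c * T%:R)^-1 *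
         \sum_(t < T)
           (#|S t|%:R / N%:R * R_sel E L etal etag CA CB Gmax
            + (1 - #|S t|%:R / N%:R)
              * R_uns E L etal etag CA CB Gmax rho))%:E)%E.
Proof.
move=> AB A B U G Gbar F F0 Gsel Gall c hsmooth hfresh hunbiased hbounded hparam
  halign hcoverage hFstar.
have c0 : 0 <= cA + cB by rewrite addr_ge0// ltW.
pose phi t i := \int[P]_w f i (U t i 0%N w).
pose gam t i := \int[P]_w (frob_norm (Gbar t i 0%N w) ^+ 2).
pose s t : R := #|S t|%:R.
have gam0 t i : 0 <= gam t i by apply: Rintegral_ge0 => w _; exact: sqr_ge0.
have bphi t i : (t <= T)%N -> ae_bounded P (fun w => f i (U t i 0%N w)).
  move=> tT; exact: (ae_bounded_start hE hg hetal hetag hS hGmax hCA hCB hsmooth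
    hbounded hparam _ hT tT).
have bgam t i : (t < T)%N -> ae_bounded P (fun w => frob_norm (Gbar t i 0%N w) ^+ 2).
  by move=> tT; apply: (ae_bounded_start_grad hg hsmooth hparam).
have sel t i : (t < T)%N -> i \in S t ->
    phi t.+1 i + etal * (cA + cB) * gam t i <=
    phi t i + R_sel E L etal etag CA CB Gmax.
  move=> tT iS.
  exact: (selected_descent hE hg hetal hetag hS hL hGmax hCA hCB hsmooth hfresh
    hunbiased hbounded hparam halign tT iS c0).
have uns t i : (t < T)%N -> i \notin S t ->
    phi t.+1 i <= phi t i + rho * etal / 2 * gam t i
    + R_uns E L etal etag CA CB Gmax rho.
  move=> tT iS.
  exact: (unselected_descent hE hg hetal hetag hS hL hGmax hCA hCB hsmooth
    hbounded hparam tT iS hrho).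
clear hfresh hunbiased hbounded hparam halign.
have n0 : (0 : R) < N%:R by rewrite ltr0n.
(* The coverage condition is pathwise; cleared of its quotient it can be integrated. Where the total
   mass vanishes the quotient gives nothing, but the left-hand side is then 0. *)
have cover t : (t < T)%N -> lambda * \sum_i gam t i <= \sum_(i in S t) gam t i.
  move=> tT.
  have sumE (r' : seq 'I_N) : \sum_(i <- r') gam t i =
      \int[P]_w \sum_(i <- r') frob_norm (Gbar t i 0%N w) ^+ 2.
    by rewrite Rintegral_ae_bounded_sum// => i; exact: bgam.
  have bsum (r' : seq 'I_N) :
      ae_bounded P (fun w => \sum_(i <- r') frob_norm (Gbar t i 0%N w) ^+ 2).
    by apply: ae_bounded_sum => i; exact: bgam.
  rewrite -[leRHS]big_filter !sumE -Rintegral_ae_boundedZ//.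
  apply: ae_le_Rintegral => //; first exact: ae_boundedZ.
  apply: filterS hcoverage => w /(_ t tT); rewrite big_filter.
  have sum0 (D : {set 'I_N}) : 0 <= \sum_(i in D) frob_norm (Gbar t i 0%N w) ^+ 2.
    by apply: sumr_ge0 => i _; exact: sqr_ge0.
  have : 0 <= Gall t w by rewrite mulr_ge0 ?invr_ge0// sumr_ge0// => i _; exact: sqr_ge0.
  rewrite le_eqVlt => /predU1P[/esym/eqP|Gpos /(_ Gpos)].
    by rewrite mulf_eq0 invr_eq0 (gt_eqF n0) /= => /eqP->; rewrite mulr0.
  by rewrite ler_pdivlMr// /Gall /Gsel mulrCA ler_pM2l// invr_gt0.
have round t : (t < T)%N -> \sum_i phi t.+1 i + etal * c * \sum_i gam t i <=
    \sum_i phi t i + s t * R_sel E L etal etag CA CB Gmax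
    + (N%:R - s t) * R_uns E L etal etag CA CB Gmax rho.
  move=> tT; have cov := cover t tT.
  (* The indicator of selection merges the two descent inequalities into one that can be summed over
     all clients. *)
  pose delta i : R := (i \in S t)%:R.
  have each i : phi t.+1 i + etal * (cA + cB) * (delta i * gam t i) <=
      phi t i + (rho * etal / 2 * (gam t i - delta i * gam t i)
      + (R_uns E L etal etag CA CB Gmax rho + delta i *
        (R_sel E L etal etag CA CB Gmax - R_uns E L etal etag CA CB Gmax rho))).
    rewrite /delta; case: (boolP (i \in S t)) => iS; last first.
      by have := uns t i tT iS; rewrite !mul0r; lra.
    by have := sel t i tT iS; rewrite !mul1r; lra.
  move: each; move: (R_uns _ _ _ _ _ _ _ _) (R_sel _ _ _ _ _ _ _) => u v each.
  have deltaE (h : 'I_N -> R) : \sum_i delta i * h i = \sum_(i in S t) h i.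
    rewrite [RHS]big_mkcond; apply: eq_bigr => i _.
    by rewrite /delta; case: (i \in S t); rewrite ?mul1r ?mul0r.
  have := ler_sum (index_enum 'I_N) (P := xpredT) (fun i _ => each i).
  rewrite !big_split /= -!mulr_sumr big_split /= sumrN !deltaE !sumr_const card_ord.
  rewrite -[u *+ _]mulr_natl -[(v - u) *+ _]mulr_natl -/(s t) /c /rate_const.
  have k1 : kappa * E%:R <= 1.
    by case/andP: hkappa => _; rewrite -[_^-1]div1r ler_pdivlMr// ltr0n.
  have k0 : 0 <= kappa by case/andP: hkappa.
  have GA0 : 0 <= \sum_i gam t i by apply: sumr_ge0 => i _.
  move: cov GA0.
  move: (\sum_(i in S t) gam t i) (\sum_i gam t i) => GS GA cov GA0.
  set a := \sum_i phi t.+1 i; set b := \sum_i phi t i => h.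
  have GS0 : 0 <= GS by apply: le_trans cov; rewrite mulr_ge0// ltW.
  (* The coefficient of the selected mass has two sources: the descent, and the [rho / 2] that
     selected clients do not lose. Multiplied by [lambda] and diminished by [rho / 2], it is [c]. *)
  have h1 : etal * ((cA + cB) * (kappa * E%:R) + rho / 2) * (lambda * GA) <=
      etal * ((cA + cB) * (kappa * E%:R) + rho / 2) * GS.
    rewrite ler_wpM2l// mulr_ge0 ?(ltW hetal)// addr_ge0 ?divr_ge0 ?(ltW hrho)//.
    by rewrite !mulr_ge0.
  (* Here the gain of a full step is lowered by the factor [kappa * E%:R] that enters [c]. *)
  have h2 : etal * (cA + cB) * GS * (kappa * E%:R) <= etal * (cA + cB) * GS * 1.
    by rewrite ler_wpM2l// !mulr_ge0// ltW.
  by move: h h1 h2; clear; lra.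
have total : \sum_i phi T i + etal * c * \sum_(t < T) \sum_i gam t i <=
    \sum_i phi 0%N i + \sum_(t < T) (s t * R_sel E L etal etag CA CB Gmax
    + (N%:R - s t) * R_uns E L etal etag CA CB Gmax rho).
  elim: {-2}T (leqnn T) => [|k IHk] kT; first by rewrite !big_ord0 mulr0.
  rewrite !big_ord_recr /= mulrDr.
  by have := IHk (ltnW kT); have := round k kT; lra.
(* The initial factors are deterministic, so these expectations are those of constants. *)
have phi0 : \sum_i phi 0%N i = N%:R * F0.
  rewrite /F0 mulVKf ?gt_eqF//; apply: eq_bigr => i _.
  exact: (Rintegral_probability_cst P (f i (update (join_factors q0 (p0 i))))).
have phiT : N%:R * Fstar <= \sum_i phi T i.
  rewrite -[leLHS](Rintegral_probability_cst P) -Rintegral_ae_bounded_sum;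
    last by move=> i; exact: bphi.
  apply: ae_le_Rintegral.
  - exact: ae_bounded_cst.
  - by apply: ae_bounded_sum => i; exact: bphi.
  apply: filterS hFstar => w /(_ T (leqnn T)).
  by rewrite -(ler_pM2l n0) /F mulVKf ?gt_eqF.
have expE t i : (t < T)%N ->
    ('E_P[fun w => (frob_norm (grad (f i) (U t i 0%N w)) ^+ 2)%R] = (gam t i)%:E)%E.
  move=> tT; rewrite unlock /gam /Rintegral fineK//.
  exact/integrable_fin_num/ae_bounded_integrable/bgam.
rewrite (eq_bigr (fun t : 'I_T => (\sum_i gam t i)%:E)); last first.
  by move=> t _; rewrite -sumEFin; apply: eq_bigr => i _; exact: expE.
rewrite sumEFin -EFinM lee_fin.
have ec0 : 0 < etal * c by rewrite mulr_gt0.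
have T0 : (0 : R) < T%:R by rewrite ltr0n.
have sumR : \sum_(t < T) (s t * R_sel E L etal etag CA CB Gmax
      + (N%:R - s t) * R_uns E L etal etag CA CB Gmax rho) =
    N%:R * \sum_(t < T) (#|S t|%:R / N%:R * R_sel E L etal etag CA CB Gmax
      + (1 - #|S t|%:R / N%:R) * R_uns E L etal etag CA CB Gmax rho).
  rewrite mulr_sumr; apply: eq_bigr => t _; rewrite -/(s t); field.
  by rewrite gt_eqF.
rewrite phi0 sumR in total.
set X := \sum_(t < T) \sum_i gam t i in total *.
set Y := \sum_(t < T) (_ + _) in total *.
rewrite [leRHS](_ : _ = (N%:R * T%:R)^-1 * ((etal * c)^-1 *
  (N%:R * (F0 - Fstar) + N%:R * Y))); last first.
  by field; rewrite !gt_eqF.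
rewrite ler_pM2l ?invr_gt0 ?mulr_gt0// -(ler_pM2l ec0) mulVKf ?gt_eqF//.
by move: total phiT; lra.
Qed.
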